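(* Let $\mathbb X=(X,\tau,\mathsf d,\mathfrak m)$ be an extended metric-topological measure space and let $\mathscr A$ be an algebra compatible with $\mathbb X$. Let $\hat X$, $\hat\tau$, $\iota:X\to\hat X$ and the Gelfand transform $\Gamma:\overline{\mathscr A}\to C_b(\hat X,\hat\tau)$ be associated with $\mathscr A$ as in the context. (a) $\iota$ is continuous and injective, and $\iota(X)$ is a dense subset of the compact Hausdorff space $\hat X$ endowed with the weak$^*$ topology $\hat\tau$. If $\mathscr A$ is separable with respect to the uniform norm then $\hat X$ is metrizable. (b) $\iota$ is a homeomorphism between $X$ and $\iota(X)$ if and only if $\mathscr A$ is adapted, i.e. it generates the topology $\tau$. (c) Every function $f\in\overline{\mathscr A}$ admits a unique (continuous) extension $\hat f=\Gamma f$ to $\hat X$, and the unital algebra $\hat{\mathscr A}:=\Gamma(\mathscr A)$ is uniformly dense in $C_b(\hat X,\hat\tau)$. The pull-back algebra $\mathscr A^*=\iota^*(\hat{\mathscr A})$ coincides with $\mathscr A$. (d) The measure $\hat{\mathfrak m}:=\iota_\sharp\mathfrak m$ is a Radon measure on $\hat X$ concentrated on the $\hat{\mathfrak m}$-measurable subset $\iota(X)$. (e) Let $\mathscr A_1=\{f\in\mathscr A:\mathrm{Lip}(f,X,\mathsf d)\le1\}$ and let $I$ be the directed set of all finite collections of functions in $\mathscr A_1$. Setting, for $\varphi_1,\varphi_2\in\hat X$, $$\hat{\mathsf d}_i(\varphi_1,\varphi_2):=\sup_{f\in i}|\varphi_1(f)-\varphi_2(f)|\ (i\in I),\qquad \hat{\mathsf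 d}(\varphi_1,\varphi_2):=\sup_{f\in\mathscr A_1}|\varphi_1(f)-\varphi_2(f)|=\sup_{i\in I}\hat{\mathsf d}_i(\varphi_1,\varphi_2),$$ the $\hat{\mathsf d}_i$ are continuous and bounded semidistances on $\hat X$ and $\hat{\mathsf d}$ is an extended distance on $\hat X$ satisfying $$\hat{\mathsf d}_i(\iota(x),\iota(y))=\mathsf d_i(x,y),\qquad \hat{\mathsf d}(\iota(x),\iota(y))=\mathsf d(x,y)\qquad\text{for every }x,y\in X,$$ where $\mathsf d_i(x,y)=\sup_{f\in i}|f(x)-f(y)|$. (f) $\iota$ is a measure-preserving embedding of $(\mathbb X,\mathscr A)$ into the compact extended metric-topological measure space $\hat{\mathbb X}:=(\hat X,\hat\tau,\hat{\mathsf d},\hat{\mathfrak m})$ endowed with the compatible algebra $\hat{\mathscr A}=\Gamma(\mathscr A)$. (g) For every $p\in[1,\infty)$ the map $\iota_*:L^p(X,\mathfrak m)\to L^p(\hat X,\hat{\mathfrak m})$ is the unique linear isometric extension of $\Gamma:\mathscr A\to\hat{\mathscr A}$ to $L^p(X,\mathfrak m)$.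
   Context: An extended (semi)distance on $X$ is a symmetric map $\mathsf d:X\times X\to[0,\infty]$ satisfying the triangle inequality and vanishing on the diagonal (a distance if moreover $\mathsf d(x,y)=0$ only for $x=y$). For $f:X\to\mathbb R$ and $A\subset X$, $\mathrm{Lip}(f,A,\mathsf d)=\inf\{L\in[0,\infty]:|f(y)-f(z)|\le L\,\mathsf d(y,z)\ \forall y,z\in A\}$. For a Hausdorff space $(X,\tau)$, $C_b(X,\tau)$ is the space of bounded $\tau$-continuous real functions, $\mathrm{Lip}_b(X,\tau,\mathsf d)=\{f\in C_b(X,\tau):\mathrm{Lip}(f,X,\mathsf d)<\infty\}$, $\mathrm{Lip}_{b,1}(X,\tau,\mathsf d)$ its subset with $\mathrm{Lip}(f,X,\mathsf d)\le1$. $(X,\tau,\mathsf d)$ is an extended metric-topological (e.m.t.) space if $\mathsf d$ is an extended distance, $\tau$ is the initial topology generated by $\mathrm{Lip}_b(X,\tau,\mathsf d)$ and $\mathsf d(x,y)=\sup_{f\in\mathrm{Lip}_{b,1}(X,\tau,\mathsf d)}|f(x)-f(y)|$ for all $x,y$. An extended metric-topological measure space is $\mathbb X=(X,\tau,\mathsf d,\mathfrak m)$ with $(X,\tau,\mathsf d)$ an e.m.t. space and $\mathfrak m$ a finite nonnegative Radon measure (Borel, inner regular by compact sets). An algebra compatible with $\mathbb X$ is a unital subalgebra $\mathscr A\subset\mathrm{Lip}_b(X,\tau,\mathsf d)$ with $\mathsf d(x,y)=\sup\{|f(x)-f(y)|:f\in\mathscr A,\ \mathrm{Lip}(f,X,\mathsf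 d)\le1\}$ for all $x,y$; it is adapted if in addition it generates $\tau$ (i.e. $\tau$ is the initial topology of $\mathscr A$). Gelfand construction. $\mathscr A$ is regarded as a subspace of $C_b(X,\tau)$ with the sup norm, $\overline{\mathscr A}$ is its uniform closure, $\mathscr A^*$ (dual) is the dual Banach space of $(\mathscr A,\|\cdot\|_\infty)$ with the weak$^*$ topology $\hat\tau$. $\hat X\subset\mathscr A^*$ is the set of characters, i.e. nonzero $\varphi$ in the dual with $\varphi(fg)=\varphi(f)\varphi(g)$ for all $f,g\in\mathscr A$ (each $\varphi$ extends by continuity to $\overline{\mathscr A}$); $\hat X$ is weak$^*$ compact and is endowed with the restriction of $\hat\tau$. $\iota:X\to\hat X$ is $\iota(x)(f)=f(x)$, and $\Gamma:\overline{\mathscr A}\to C_b(\hat X,\hat\tau)$ is $(\Gamma f)(\varphi)=\varphi(f)$; $\hat f=\Gamma f$ extends $f$ in the sense $\hat f\circ\iota=f$. Embeddings. For $f':X'\to\mathbb R$, $\iota^*f'=f'\circ\iota$. Given e.m.t.m. spaces $\mathbb X,\mathbb X'$ with compatible algebras $\mathscr A,\mathscr A'$, a map $\iota:X\to X'$ is a measure-preserving embedding of $(\mathbb X,\mathscr A)$ into $(\mathbb X',\mathscr A')$ if it is continuous and injective from $(X,\tau)$ to $(X',\tau')$, $\mathsf d'(\iota(x),\iota(y))=\mathsf d(x,y)$ for all $x,y$, $\iota_\sharp\mathfrak m=\mathfrak m'$, and $\iota^*f'\in\mathscr A$ for every $f'\in\mathscr A'$. For such an embedding $\iota^*$ induces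 a linear isometric isomorphism of $L^p(X',\mathfrak m')$ onto $L^p(X,\mathfrak m)$ whose inverse is denoted $\iota_*$. *)

(* Defs.v *)
From HB Require Import structures.
From mathcomp Require Import all_boot all_order all_algebra.
From mathcomp Require Import all_classical all_reals all_analysis.
From mathcomp Require Import measurable_realfun.

Set Implicit Arguments.
Unset Strict Implicit.
Unset Printing Implicit Defensive.

Import Order.TTheory GRing.Theory Num.Theory.
Import numFieldNormedType.Exports.

Local Open Scope classical_set_scope.
Local Open Scope ring_scope.

Section ExtendedDistances.
Context {R : realType}.

Record ext_semidistance (X : Type) (d : X -> X -> \bar R) : Prop := {
  esd_ge0 : forall x y, (0 <= d x y)%E ;
  esd_xx : forall x, d x x = 0%E ;
  esd_sym : forall x y, d x y = d y x ;
  esd_triangle : forall x y z, (d x z <= d x y + d y z)%E }.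

Definition ext_distance (X : Type) (d : X -> X -> \bar R) : Prop :=
  ext_semidistance d /\ forall x y, d x y = 0%E -> x = y.

(* In the library [0 * +oo = 0]; the value of [Lip] does not depend on the
   convention used for that product. *)
Definition Lip (X : Type) (f : X -> R) (A : set X) (d : X -> X -> \bar R) : \bar R :=
  ereal_inf [set L : \bar R | (0 <= L)%E /\
    forall y z, A y -> A z -> (`|f y - f z|%:E <= L * d y z)%E].

Definition Cb (X : topologicalType) : set (X -> R) :=
  [set f | continuous f /\ bounded_fun f].

Definition Lipb (X : topologicalType) (d : X -> X -> \bar R) : set (X -> R) :=
  [set f | Cb f /\ (Lip f [set: X] d < +oo)%E].

Definition Lipb1 (X : topologicalType) (d : X -> X -> \bar R) : set (X -> R) :=
  [set f | Lipb d f /\ (Lip f [set: X] d <= 1)%E].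

(* The initial topology of a family of functions is the supremum of the initial
   topologies of its members. *)
Definition family_initial_topology (X : choiceType) (F : set (X -> R)) : Type :=
  sup_topology (fun f : F =>
    Topological.class (initial_topology (set_val f : X -> R))).

HB.instance Definition _ (X : choiceType) (F : set (X -> R)) :=
  Topological.copy (family_initial_topology F)
    (sup_topology (fun f : F =>
      Topological.class (initial_topology (set_val f : X -> R)))).

Definition generates_topology (X : topologicalType) (F : set (X -> R)) : Prop :=
  forall U : set X, open U <-> open (U : set (family_initial_topology F)).

Record emt_space (X : topologicalType) (d : X -> X -> \bar R) : Prop := {
  emt_hausdorff : hausdorff_space X ;
  emt_distance : ext_distance d ;
  emt_topology : generates_topology (Lipb d) ;
  emt_sup : forall x y,
    d x y = ereal_sup [set `|f x - f y|%:E | f in Lipb1 d] }.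

End ExtendedDistances.

(* The library's measurable types are nonempty (pointed), hence so are the
   spaces that carry a measure. *)
Definition borel (X : ptopologicalType) : Type := g_sigma_algebraType (@open X).

HB.instance Definition _ (X : ptopologicalType) :=
  Measurable.copy (borel X) (g_sigma_algebraType (@open X)).

Section EmtmSpaces.
Context {R : realType}.

(* The finiteness of the measure is part of its type. *)
Definition radon (X : ptopologicalType)
    (m : {finite_measure set (borel X) -> \bar R}) : Prop :=
  forall B : set (borel X), measurable B ->
    m B = ereal_sup [set m K | K in [set K : set X | compact K /\ K `<=` B]].

Definition emtm_space (X : ptopologicalType) (d : X -> X -> \bar R)
    (m : {finite_measure set (borel X) -> \bar R}) : Prop :=
  emt_space d /\ radon m.

Definition unital_subalgebra (X : Type) (A : set (X -> R)) : Prop :=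
  [/\ A (cst 1),
      (forall f g, A f -> A g -> A (f \+ g)),
      (forall (a : R) f, A f -> A (fun x => a * f x)) &
      (forall f g, A f -> A g -> A (f \* g))].

Definition compatible_algebra (X : topologicalType) (d : X -> X -> \bar R)
    (A : set (X -> R)) : Prop :=
  [/\ unital_subalgebra A, A `<=` Lipb d &
      forall x y, d x y = ereal_sup [set `|f x - f y|%:E |
        f in [set f | A f /\ (Lip f [set: X] d <= 1)%E]]].

Definition adapted_algebra (X : topologicalType) (d : X -> X -> \bar R)
    (A : set (X -> R)) : Prop :=
  compatible_algebra d A /\ generates_topology A.

Definition measure_preserving_embedding (X X' : ptopologicalType)
    (d : X -> X -> \bar R) (d' : X' -> X' -> \bar R)
    (m : {finite_measure set (borel X) -> \bar R})
    (m' : {finite_measure set (borel X') -> \bar R})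
    (A : set (X -> R)) (A' : set (X' -> R)) (j : X -> X') : Prop :=
  [/\ continuous j /\ injective j,
      (forall x y, d' (j x) (j y) = d x y),
      (forall B : set (borel X'), measurable B ->
         pushforward m (j : borel X -> borel X') B = m' B) &
      (forall f', A' f' -> A (f' \o j))].

End EmtmSpaces.

Definition separable_space (T : topologicalType) : Prop :=
  exists2 D : set T, countable D & dense D.

Definition metrizable (R : realType) (T : topologicalType) : Prop :=
  exists rho : T -> T -> R,
    [/\ (forall x y, rho x y = 0 <-> x = y),
        (forall x y, rho x y = rho y x),
        (forall x y z, rho x z <= rho x y + rho y z) &
        (forall x (U : set T), nbhs x U <->
           exists2 e : R, 0 < e & [set y | rho x y < e] `<=` U)].

Definition homeo_onto_image (X Y : topologicalType) (j : X -> Y) : Prop :=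
  continuous j /\
  exists g : Y -> X, cancel j g /\ {within range j, continuous g}.

Record compat_algebra (R : realType) (X : topologicalType)
    (d : X -> X -> \bar R) := CompatAlgebra {
  alg_set :> set (X -> R) ;
  alg_compatible : compatible_algebra d alg_set }.

Section AlgebraPredicate.
Context {R : realType} {X : topologicalType} {d : X -> X -> \bar R}.
Variable A : compat_algebra d.

Definition alg_pred : {pred X -> R^o} := mem (alg_set A).

Let alg_submod_closed : submod_closed alg_pred.
Proof.
have [[A1 AD AZ _] _ _] := alg_compatible A.
have A0 : alg_set A (0 : X -> R^o).
  rewrite (_ : (0 : X -> R^o) = (fun x => 0 * cst 1 x)); first exact: AZ.
  by apply/funext => x /=; rewrite mul0r.
split; first exact: mem_set.
by move=> a f g /set_mem Af /set_mem Ag; apply/mem_set/AD => //; exact: AZ.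
Qed.

Let alg_mulr_closed : mulr_closed alg_pred.
Proof.
have [[A1 _ _ AM] _ _] := alg_compatible A.
split; first exact: mem_set.
by move=> f g /set_mem Af /set_mem Ag; apply/mem_set/AM.
Qed.

HB.instance Definition _ :=
  GRing.isSubmodClosed.Build R (X -> R^o) alg_pred alg_submod_closed.
HB.instance Definition _ :=
  GRing.isMulClosed.Build (X -> R^o) alg_pred alg_mulr_closed.

End AlgebraPredicate.

(* The elements of A as a type, which receives below the pointwise algebra
   structure and the sup norm. *)
Definition alg {R : realType} {X : topologicalType} {d : X -> X -> \bar R}
  (A : compat_algebra d) : Type := {f : X -> R^o | f \in alg_pred A}.

Section AlgebraType.
Context {R : realType} {X : topologicalType} {d : X -> X -> \bar R}.
Variable A : compat_algebra d.

HB.instance Definition _ := SubChoice.on (alg A).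
HB.instance Definition _ := [SubChoice_isSubLmodule of alg A by <:].
HB.instance Definition _ := 
  GRing.SubZmodule_isSubPzRing.Build _ _ (alg A) (subringClosedP (alg_pred A)).

Definition alg_fun (f : alg A) : X -> R := val f.

Lemma alg_funP (f : alg A) : alg_set A (alg_fun f).
Proof. exact/set_mem/(valP f). Qed.

Definition supnorm (f : alg A) : R := sup (range (fun x => `|alg_fun f x|)).

Let has_ub (f : alg A) : has_ubound (range (fun x => `|alg_fun f x|)).
Proof.
have [_ AL _] := alg_compatible A.
have [[_ [M [_ fM]]] _] := AL _ (alg_funP f).
by exists (M + 1) => _ [x _ <-]; apply: fM; rewrite ?ltrDl.
Qed.

Lemma le_supnorm (f : alg A) x : `|alg_fun f x| <= supnorm f.
Proof. by apply: ub_le_sup; [exact: has_ub|exists x]. Qed.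

Lemma supnorm_le (f : alg A) M : 0 <= M ->
  (forall x, `|alg_fun f x| <= M) -> supnorm f <= M.
Proof.
move=> M0 fM; rewrite /supnorm.
have [->|/set0P ne] := eqVneq (range (fun x => `|alg_fun f x|)) set0.
  by rewrite sup0.
by apply: ge_sup => // _ [x _ <-].
Qed.

Lemma supnorm_ge0 (f : alg A) : 0 <= supnorm f.
Proof.
have [e|/set0P[_ [x _ _]]] := eqVneq (range (fun x => `|alg_fun f x|)) set0.
  by rewrite /supnorm e sup0.
exact: le_trans (le_supnorm f x).
Qed.

Let supnormD (f g : alg A) : supnorm (f + g) <= supnorm f + supnorm g.
Proof.
apply: supnorm_le => [|x]; first by rewrite addr_ge0// supnorm_ge0.
apply: le_trans (lerD (le_supnorm f x) (le_supnorm g x)).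
exact: ler_normD.
Qed.

Let supnormZ_le a (f : alg A) : supnorm (a *: f) <= `|a| * supnorm f.
Proof.
apply: supnorm_le => [|x]; first by rewrite mulr_ge0// supnorm_ge0.
by rewrite [alg_fun _ x]/(a * alg_fun f x) normrM ler_wpM2l// le_supnorm.
Qed.

Let supnormZ a (f : alg A) : supnorm (a *: f) = `|a| * supnorm f.
Proof.
apply/eqP; rewrite eq_le supnormZ_le/=.
have [->|a0] := eqVneq a 0; first by rewrite normr0 mul0r supnorm_ge0.
rewrite -ler_pdivlMl ?normr_gt0// -normfV.
by rewrite -{1}[f](scalerK a0) supnormZ_le.
Qed.

Let supnorm_eq0 (f : alg A) : supnorm f = 0 -> f = 0.
Proof.
move=> f0; apply/val_inj/funext => x; apply/eqP.
by rewrite -normr_le0 -f0 le_supnorm.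
Qed.

HB.instance Definition _ :=
  Lmodule_isNormed.Build R (alg A) supnormD supnormZ supnorm_eq0.

Lemma alg_normE (f : alg A) : `|f| = sup (range (fun x => `|alg_fun f x|)).
Proof. by []. Qed.

End AlgebraType.
Coercion alg_fun : alg >-> Funclass.

Section Gelfand.
Context {R : realType} {X : ptopologicalType} {d : X -> X -> \bar R}.
Variable A : compat_algebra d.

Definition dual_space : Type :=
  set_type [set phi : {linear alg A -> R^o} | continuous phi].

HB.instance Definition _ := Choice.on dual_space.

Definition dual_fun (phi : dual_space) : {ptws alg A -> R^o} := val phi.

(* The weak* topology: [{ptws _ -> _}] carries the initial topology of the
   evaluation maps. *)
HB.instance Definition _ := Topological.copy dual_space (initial_topology dual_fun).

Definition character : set dual_space :=
  [set phi | (exists f, dual_fun phi f <> 0) /\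
    forall f g, dual_fun phi (f * g) = dual_fun phi f * dual_fun phi g].

Definition Xhat : Type := set_type character.

HB.instance Definition _ := Topological.on Xhat.

Definition char_fun (phi : Xhat) : alg A -> R := dual_fun (val phi).

Definition evaluation (x : X) (f : alg A) : R^o := f x.

Let evaluation_linear x : linear (evaluation x).
Proof. by []. Qed.

HB.instance Definition _ x := GRing.isLinear.Build R (alg A) R^o *:%R
  (evaluation x) (evaluation_linear x).

Lemma evaluation_continuous x : continuous (evaluation x).
Proof.
move=> f; apply/(@cvgrPdist_lt _ _ _ (nbhs f)) => e e0.
apply: filterS (nbhsx_ballx f e e0) => g; rewrite -ball_normE /= => fg.
exact: le_lt_trans (le_supnorm (f - g) x) fg.
Qed.

Definition dual_evaluation (x : X) : dual_space :=
  exist _ (evaluation x : {linear alg A -> R^o})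
    (mem_set (@evaluation_continuous x)).

Lemma dual_evaluation_character x : character (dual_evaluation x).
Proof. by split=> //; exists 1; exact/eqP/oner_neq0. Qed.

Definition iotaX (x : X) : Xhat :=
  exist _ (dual_evaluation x) (mem_set (dual_evaluation_character x)).

Lemma char_fun_iota x f : char_fun (iotaX x) f = f x.
Proof. by []. Qed.

HB.instance Definition _ := isPointed.Build Xhat (iotaX point).

Definition uclosure : set (X -> R) := closure (alg_set A : set {uniform X -> R}).

(* The extension by continuity of a character to the uniform closure of A: the
   limit of phi g as g tends to f uniformly within A. *)
Definition char_ext (phi : Xhat) (f : X -> R) : R :=
  lim ((fun g : {uniform X -> R} => oapp (char_fun phi) 0 (insub (g : X -> R^o)))
       @ within (alg_set A) (nbhs (f : {uniform X -> R}))).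

Definition Gamma (f : X -> R) : Xhat -> R := fun phi => char_ext phi f.

End Gelfand.

Arguments iotaX {R X d} A x.
Arguments uclosure {R X d} A.
Arguments Gamma {R X d} A f phi.

(* The library provides the elements of L^p as classes of measurable functions,
   but no algebraic or normed structure on them: it is supplied here. *)
Section LpSpace.
Context d {T : measurableType d} {R : realType}.
Variables (mu : {measure set T -> \bar R}) (p : R) (p1 : (1 <= p%:E)%E).

Local Notation L := (LspaceType mu p1).
Local Notation F := (LfunType mu p1).
Local Notation M := {mfun T >-> measurableTypeR R}.
Local Notation Q := {mfun_ mu, T >-> measurableTypeR R}.

Lemma eq_ae_Lnorm (f g : T -> R) : measurable_fun setT f -> measurable_fun setT g ->
  f = g %[ae mu] -> ('N[mu]_p%:E[EFin \o f] = 'N[mu]_p%:E[EFin \o g])%E.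
Proof.
move=> mf mg fg; rewrite unlock /Lnorm; congr (_ `^ _)%E.
apply: ae_eq_integral => //.
- apply/measurable_EFinP/(@measurableT_comp _ _ _ _ _ _ (fun x : R => x `^ p)) => //.
  exact: measurableT_comp.
- apply/measurable_EFinP/(@measurableT_comp _ _ _ _ _ _ (fun x : R => x `^ p)) => //.
  exact: measurableT_comp.
by apply: filterS fg => x + _ => /(_ I) /= ->.
Qed.

Let mfun_subproof (f : F) : measurable_fun [set: T] (f : T -> measurableTypeR R).
Proof. exact: (@measurable_funPT _ _ T R f). Qed.

Let to_mfun (f : F) : M :=
  HB.pack (f : T -> measurableTypeR R) (isMeasurableFun.Build _ _ _ _ _ (mfun_subproof f)).

Local Open Scope quotient_scope.

Let M_measurable (f : M) : measurable_fun [set: T] (f : T -> R).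
Proof. exact: (@measurable_funPT _ _ T (measurableTypeR R) f). Qed.

Let repr_pi_ae (f : M) : repr (\pi_Q f) = f %[ae mu].
Proof.
apply/asboolP; have : repr (\pi_Q f) = f %[mod Q] by rewrite reprK.
by move/eqP; rewrite eqmodE.
Qed.

Let pi_finite_norm (f : F) : finite_norm mu p%:E (\pi_Q (to_mfun f) : Q).
Proof.
rewrite /finite_norm /aqEqMfun_to_fun (@eq_ae_Lnorm _ f).
- exact: (@Lfunction_finite _ _ _ _ _ p1 f).
- exact: M_measurable.
- exact: measurable_funPT.
- exact: repr_pi_ae.
Qed.

Definition Lclass (f : F) : L :=
  HB.pack (\pi_Q (to_mfun f) : Q) (isFinLebesgue.Build _ _ _ _ _ p1 _ (pi_finite_norm f)).

Let Lrepr_subproof (u : L) : (repr (LebesgueSpace.sort u) : T -> R) \in Lfun mu p%:E.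
Proof.
apply/andP; split; rewrite inE /=; first exact: M_measurable.
exact: (@Lebesgue_finite _ _ _ _ _ _ u).
Qed.

Definition Lrepr (u : L) : F := Lfun_Sub p1 (Lrepr_subproof u).

Lemma LclassK (f : F) : Lrepr (Lclass f) = f %[ae mu].
Proof. exact: repr_pi_ae. Qed.

Lemma Lspace_inj (u v : L) : LebesgueSpace.sort u = LebesgueSpace.sort v -> u = v.
Proof.
case: u v => [u [[hu]]] [v [[hv]]] /= uv; move: hu hv; rewrite uv => hu hv.
by rewrite (Prop_irrelevance hu hv).
Qed.

Lemma LreprK (u : L) : Lclass (Lrepr u) = u.
Proof.
apply: Lspace_inj; rewrite /= -[RHS]reprK; congr (\pi_Q _); exact: val_inj.
Qed.

Lemma eq_Lclass (f g : F) : Lclass f = Lclass g <-> f = g %[ae mu].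
Proof.
split=> [/(congr1 (@LebesgueSpace.sort _ _ _ _ _ _))/=/eqP|fg].
  by rewrite eqmodE => /asboolP.
by apply/Lspace_inj/eqP; rewrite /= eqmodE; exact/asboolP.
Qed.

Local Close Scope quotient_scope.

HB.instance Definition _ := gen_eqMixin L.
HB.instance Definition _ := gen_choiceMixin L.

Definition Ladd (u v : L) : L := Lclass (Lrepr u + Lrepr v).
Definition Lopp (u : L) : L := Lclass (- Lrepr u).
Definition Lscale (a : R) (u : L) : L := Lclass (a *: Lrepr u).
Definition Lnormp (u : L) : R := fine ('N[mu]_p%:E[EFin \o Lrepr u])%E.

Lemma Lclass_add (f g : F) : Lclass (f + g) = Ladd (Lclass f) (Lclass g).
Proof.
apply/eq_Lclass; apply: filterS2 (LclassK f) (LclassK g) => x + + _.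
by move=> /(_ I) fx /(_ I) gx; exact: (congr2 +%R (esym fx) (esym gx)).
Qed.

Lemma Lclass_opp (f : F) : Lclass (- f) = Lopp (Lclass f).
Proof.
apply/eq_Lclass; apply: filterS (LclassK f) => x + _.
by move=> /(_ I) fx; exact: (congr1 -%R (esym fx)).
Qed.

Lemma Lclass_scale a (f : F) : Lclass (a *: f) = Lscale a (Lclass f).
Proof.
apply/eq_Lclass; apply: filterS (LclassK f) => x + _.
by move=> /(_ I) fx; exact: (congr1 ( *%R a) (esym fx)).
Qed.

Lemma Lclass_norm (f : F) : Lnormp (Lclass f) = fine ('N[mu]_p%:E[EFin \o f])%E.
Proof.
rewrite /Lnormp (@eq_ae_Lnorm _ f) //; exact: LclassK.
Qed.

Let Lind (P : L -> Prop) : (forall f : F, P (Lclass f)) -> forall u, P u.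
Proof. by move=> h u; rewrite -(LreprK u); exact: h. Qed.

Let LaddA : associative Ladd.
Proof.
elim/Lind=> f; elim/Lind=> g; elim/Lind=> h.
by rewrite -!Lclass_add addrA.
Qed.

Let LaddC : commutative Ladd.
Proof. by elim/Lind=> f; elim/Lind=> g; rewrite -!Lclass_add addrC. Qed.

Let Ladd0 : left_id (Lclass 0) Ladd.
Proof. by elim/Lind=> f; rewrite -Lclass_add add0r. Qed.

Let LaddN : left_inverse (Lclass 0) Lopp Ladd.
Proof. by elim/Lind=> f; rewrite -Lclass_opp -Lclass_add addNr. Qed.

HB.instance Definition _ := GRing.isZmodule.Build L LaddA LaddC Ladd0 LaddN.

Let LscaleA a b (u : L) : Lscale a (Lscale b u) = Lscale (a * b) u.
Proof. by elim/Lind: u => f; rewrite -!Lclass_scale scalerA. Qed.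

Let Lscale1 : left_id 1 Lscale.
Proof. by elim/Lind => f; rewrite -Lclass_scale scale1r. Qed.

Let LscaleDr : right_distributive Lscale +%R.
Proof.
move=> a; elim/Lind => f; elim/Lind=> g.
transitivity (Lclass (a *: (f + g))); first by rewrite Lclass_scale Lclass_add.
by rewrite scalerDr Lclass_add !Lclass_scale.
Qed.

Let LscaleDl (u : L) : {morph Lscale^~ u : a b / a + b}.
Proof.
elim/Lind: u => f a b /=.
by rewrite -Lclass_scale scalerDl Lclass_add !Lclass_scale.
Qed.

HB.instance Definition _ :=
  GRing.Zmodule_isLmodule.Build R L LscaleA Lscale1 LscaleDr LscaleDl.

Let LnormD (u v : L) : Lnormp (u + v) <= Lnormp u + Lnormp v.
Proof.
elim/Lind: u => f; elim/Lind: v => g.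
have -> : Lclass f + Lclass g = Lclass (f + g) by rewrite Lclass_add.
by rewrite !Lclass_norm; exact: ler_LnormD.
Qed.

Let LnormZ a (u : L) : Lnormp (a *: u) = `|a| * Lnormp u.
Proof.
elim/Lind: u => f.
have -> : a *: Lclass f = Lclass (a *: f) by rewrite Lclass_scale.
rewrite !Lclass_norm.
by apply: EFin_inj; rewrite EFinM !finite_norm_fine; exact: LnormZ.
Qed.

Let Lnorm_eq0 (u : L) : Lnormp u = 0 -> u = 0.
Proof.
elim/Lind: u => f; rewrite Lclass_norm => /fine_Lnormr_eq0 f0.
by apply/eq_Lclass.
Qed.

HB.instance Definition _ := Lmodule_isNormed.Build R L LnormD LnormZ Lnorm_eq0.

End LpSpace.

Section Borel.
Context {R : realType}.

Lemma continuous_measurable_borel (X Y : ptopologicalType) (j : X -> Y) :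
  continuous j -> measurable_fun [set: borel X] (j : borel X -> borel Y).
Proof.
move=> /continuousP cj; apply: (@measurability _ _ (borel X) (borel Y) setT j (@open Y)) => //.
by move=> _ [U oU <-]; rewrite setTI; apply: sub_sigma_algebra; exact: cj.
Qed.

Lemma Cb_measurable (X : ptopologicalType) (f : X -> R) :
  Cb f -> measurable_fun [set: borel X] (f : borel X -> R).
Proof.
move=> [/continuousP cf _]; apply: (measurability _ (RGenOpens.measurableE R)).
move=> _ [_ [a [b ->] <-]]; rewrite setTI; apply: sub_sigma_algebra.
exact/cf/interval_open.
Qed.

Lemma Cb_Lfun (X : ptopologicalType)
    (m : {finite_measure set (borel X) -> \bar R}) (p : R) (f : X -> R) :
  (1 <= p%:E)%E -> Cb f -> (f : borel X -> R) \in Lfun m p%:E.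
Proof.
move=> p1 Cf; have mf := Cb_measurable Cf.
apply/andP; split; rewrite inE //= /finite_norm unlock /Lnorm.
have [_ [M [_ fM]]] := Cf.
have {}fM x : `|f x| <= `|M| + 1.
  by apply: fM => //; rewrite (le_lt_trans (ler_norm _))// ltrDl.
rewrite poweR_lty//.
apply: (@le_lt_trans _ _ (\int[m]_x ((`|M| + 1) `^ p)%:E)%E).
  apply: ge0_le_integral => //.
  - by move=> x _; rewrite lee_fin powR_ge0.
  - apply/measurable_EFinP/(@measurableT_comp _ _ _ _ _ _ (fun x : R => x `^ p)) => //.
    exact: measurableT_comp.
  - by move=> x _; rewrite lee_fin ge0_ler_powR// ?nnegrE// ?addr_ge0//
      -?lee_fin ?(le_trans _ p1)// lee_fin.
by rewrite integral_cst// ltey_eq fin_numM// fin_num_measure.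
Qed.

End Borel.

(* The class in L^p of a bounded continuous function. *)
Definition Lcb {R : realType} {X : ptopologicalType}
    (m : {finite_measure set (borel X) -> \bar R}) (p : R) (p1 : (1 <= p%:E)%E)
    (f : X -> R) (Cf : Cb f) : LspaceType m p1 :=
  Lclass (Lfun_Sub p1 (Cb_Lfun m p1 Cf)).

(* The map j^* induced on L^p by a measure-preserving map j. *)
Section Pullback.
Context d d' {T : measurableType d} {T' : measurableType d'} {R : realType}.
Variables (m : {measure set T -> \bar R}) (m' : {measure set T' -> \bar R}).
Variables (j : T -> T') (mj : measurable_fun [set: T] j).
Hypothesis jm : forall B, measurable B -> pushforward m j B = m' B.
Variables (p : R) (p1 : (1 <= p%:E)%E).

Lemma Lfun_pullback (f : LfunType m' p1) : (f : T' -> R) \o j \in Lfun m p%:E.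
Proof.
have mf : measurable_fun [set: T'] f by exact: measurable_funPT.
have mfp : measurable_fun [set: T'] (fun x => (`|f x| `^ p)%:E).
  apply/measurable_EFinP/(@measurableT_comp _ _ _ _ _ _ (fun x : R => x `^ p)) => //.
  exact: measurableT_comp.
apply/andP; split; rewrite inE /=; first exact: measurableT_comp.
have := @Lfunction_finite _ _ _ _ _ p1 f.
rewrite /finite_norm unlock /Lnorm /=; congr (_ `^ _ < _)%E.
have f0 : {in [set: T'], forall y, (0 <= (`|f y| `^ p)%:E)%E}.
  by move=> y _; rewrite lee_fin powR_ge0.
rewrite -[RHS](ge0_integral_pushforward mj m measurableT mfp f0).
by apply: eq_measure_integral => B mB _; rewrite -(jm mB).
Qed.

Definition Lp_pullback (u : LspaceType m' p1) : LspaceType m p1 :=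
  Lclass (Lfun_Sub p1 (Lfun_pullback (Lrepr u))).

End Pullback.

Arguments Lp_pullback {d d' T T' R m m' j} mj jm {p} p1 u.

Section GelfandProperties.
Context {R : realType} {X : ptopologicalType} {d : X -> X -> \bar R}.
Variable A : compat_algebra d.

Lemma alg_Cb (f : alg A) : Cb f.
Proof. by have [_ AL _] := alg_compatible A; have [] := AL _ (alg_funP f). Qed.

Lemma char_fun_continuous (f : alg A) :
  continuous (fun phi : Xhat A => char_fun phi f).
Proof.
move=> phi; apply: (@continuous_comp (Xhat A) (dual_space A) R val
  (fun psi : dual_space A => dual_fun psi f)); first exact: initial_continuous.
apply: (@continuous_comp (dual_space A) {ptws alg A -> R^o} R (@dual_fun _ _ _ A)
  (fun h => h f)); first exact: initial_continuous.
exact: (@proj_continuous (alg A) (fun=> R^o) f).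
Qed.

Lemma iota_continuous : continuous (iotaX A).
Proof.
apply/continuousP => _ [_ [B oB <-] <-].
suff : continuous (fun x : X => (fun f : alg A => f x) : {ptws alg A -> R^o}).
  by move=> /continuousP; exact.
move=> x; apply/(@pointwise_cvgP (alg A) R^o) => f.
exact: (alg_Cb f).1.
Qed.

Lemma alg_normX (g : alg A) n : `|g ^+ n| <= `|g| ^+ n :> R.
Proof.
elim: n => [|n ih]; first by rewrite !expr0; apply: supnorm_le => // x;
  rewrite [X in `|X|](_ : _ = 1) ?normr1.
rewrite !exprS; apply: supnorm_le => [|x]; first by rewrite mulr_ge0// exprn_ge0.
rewrite [alg_fun _ x]/(g x * alg_fun (g ^+ n) x) normrM ler_pM//.
  exact: le_supnorm.
exact: le_trans (le_supnorm _ _) ih.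
Qed.

Lemma char_fun1 (phi : Xhat A) : char_fun phi 1 = 1.
Proof.
have [[f /eqP f0] M] := set_mem (valP phi).
apply: (mulfI f0).
by rewrite -[LHS]M !mulr1.
Qed.

Lemma char_funX (phi : Xhat A) f n : char_fun phi (f ^+ n) = char_fun phi f ^+ n.
Proof.
elim: n => [|n ih]; first by rewrite !expr0 char_fun1.
have [_ M] := set_mem (valP phi).
by rewrite !exprS -ih; exact: M.
Qed.

Lemma char_funZ (phi : Xhat A) a f : char_fun phi (a *: f) = a * char_fun phi f.
Proof. exact: (linearZZ (val (val phi))). Qed.

Lemma char_funB (phi : Xhat A) f g :
  char_fun phi (f - g) = char_fun phi f - char_fun phi g.
Proof. exact: (linearB (val (val phi))). Qed.

Lemma char_fun_le (phi : Xhat A) f : `|char_fun phi f| <= `|f|.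
Proof.
rewrite leNgt; apply/negP => lt.
have c0 : char_fun phi f != 0 by rewrite -normr_gt0 (le_lt_trans _ lt).
pose g := (char_fun phi f)^-1 *: f.
have g1 : `|g| < 1 :> R.
  by rewrite normrZ normfV mulrC ltr_pdivrMr ?mul1r// normr_gt0.
have pg : char_fun phi g = 1 by rewrite char_funZ mulVf.
have cphi : continuous (val (val phi)) by exact: set_mem (valP (val phi)).
have gX : (g ^+ n) @[n --> \oo] --> (0 : alg A).
  apply/(@cvgr0Pnorm_lt _ _ _ eventually) => e e0.
  have : (`|g| ^+ n) @[n --> \oo] --> (0 : R) by apply: cvg_expr; rewrite normr_id.
  move=> /cvgr0Pnorm_lt /(_ _ e0); apply: filterS => n.
  by rewrite ger0_norm ?exprn_ge0//; exact: le_lt_trans (alg_normX g n).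
have : char_fun phi (g ^+ n) @[n --> \oo] --> char_fun phi 0.
  exact: (cvg_comp _ _ gX (cphi 0)).
rewrite (_ : char_fun phi 0 = 0); last exact: (linear0 (val (val phi))).
under eq_cvg do rewrite char_funX pg expr1n.
move=> /(cvg_unique (@Rhausdorff R) (@cvg_cst _ _ _ _ _)) => /eqP.
by rewrite oner_eq0.
Qed.

Lemma GammaE (f : alg A) (phi : Xhat A) : Gamma A f phi = char_fun phi f.
Proof.
have pF : ProperFilter (within (alg_set A) (nbhs (alg_fun f : {uniform X -> R}))).
  apply: (@within_nbhs_proper {uniform X -> R} (alg_set A) (alg_fun f)).
  exact: (@subset_closure {uniform X -> R} (alg_set A)) (alg_funP f).
apply: (@cvg_lim R) => //.
apply/(@cvgrPdist_lt _ _ _ (within _ _)) => e e0.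
apply/uniform_nbhs; exists [set xy : R * R | ball xy.1 (e / 2) xy.2]; split.
  by rewrite -entourage_ballE; exists (e / 2) => //=; rewrite divr_gt0.
move=> h /= fh Ah.
rewrite insubT; first exact: mem_set.
move=> Ah' /=; rewrite -char_funB; apply: le_lt_trans (char_fun_le _ _) _.
apply: (@le_lt_trans _ _ (e / 2)); last by rewrite ltr_pdivrMr// ltr_pMr// ltr1n.
apply: supnorm_le => [|x]; first by rewrite divr_ge0// ltW.
by apply: ltW; exact: fh.
Qed.

Lemma Gamma_Cb (f : alg A) : Cb (Gamma A f).
Proof.
rewrite (_ : Gamma A f = fun phi => char_fun phi f); last first.
  by apply/funext => phi; exact: GammaE.
split; first exact: char_fun_continuous.
exists `|f|; split; first exact: num_real.
by move=> M fM phi _ /=; apply: (le_trans (char_fun_le phi f)); exact: ltW.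
Qed.

Lemma iota_measurable :
  measurable_fun [set: borel X] (iotaX A : borel X -> borel (Xhat A)).
Proof. by apply: continuous_measurable_borel; exact: iota_continuous. Qed.

Definition mhat (m : {finite_measure set (borel X) -> \bar R}) :
    set (borel (Xhat A)) -> \bar R :=
  pushforward m (iotaX A : borel X -> borel (Xhat A)).

Section Mhat.
Variable m : {finite_measure set (borel X) -> \bar R}.

Let mhat0 : mhat m set0 = 0%E.
Proof. by rewrite /mhat /pushforward preimage_set0 measure0. Qed.

Let mhat_ge0 B : (0 <= mhat m B)%E.
Proof. by rewrite /mhat /pushforward measure_ge0. Qed.

Let mhat_sigma_additive : semi_sigma_additive (mhat m).
Proof.
move=> F mF tF mUF; rewrite /mhat /pushforward preimage_bigcup.
apply: measure_semi_sigma_additive.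
- by move=> n; rewrite -[X in measurable X]setTI; exact: iota_measurable.
- apply/trivIsetP => /= i j _ _ ij; rewrite -preimage_setI.
  by move/trivIsetP : tF => /(_ _ _ _ _ ij) ->//; rewrite preimage_set0.
- by rewrite -preimage_bigcup -[X in measurable X]setTI; exact: iota_measurable.
Qed.

HB.instance Definition _ :=
  isMeasure.Build _ _ _ (mhat m) mhat0 mhat_ge0 mhat_sigma_additive.

Let mhat_fin : fin_num_fun (mhat m).
Proof.
move=> B mB; apply: fin_num_measure.
by rewrite -[X in measurable X]setTI; exact: iota_measurable.
Qed.

HB.instance Definition _ := Measure_isFinite.Build _ _ _ (mhat m) mhat_fin.

End Mhat.

Definition iota_pullback (m : {finite_measure set (borel X) -> \bar R})
    (p : R) (p1 : (1 <= p%:E)%E) :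
    LspaceType (mhat m) p1 -> LspaceType m p1 :=
  Lp_pullback iota_measurable (fun B _ => erefl (mhat m B)) p1.

Definition A1 : set (alg A) := [set f | (Lip f [set: X] d <= 1)%E].

Definition fin_A1 : set (set (alg A)) :=
  [set i | finite_set i /\ i `<=` A1].

(* For the empty collection the library's [sup set0 = 0] is the intended
   value. *)
Definition dfin (i : set (alg A)) (x y : X) : R :=
  sup [set `|f x - f y| | f in i].

Definition dhatfin (i : set (alg A)) (phi1 phi2 : Xhat A) : R :=
  sup [set `|char_fun phi1 f - char_fun phi2 f| | f in i].

Definition dhat (phi1 phi2 : Xhat A) : \bar R :=
  ereal_sup [set `|char_fun phi1 f - char_fun phi2 f|%:E | f in A1].

End GelfandProperties.

Arguments mhat {R X d} A m.
Arguments iota_pullback {R X d} A m {p} p1.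
Arguments A1 {R X d} A.
Arguments fin_A1 {R X d} A.
Arguments dhat {R X d} A phi1 phi2.

(* Main.v *)
Require Import Defs.
From HB Require Import structures.
From mathcomp Require Import all_boot all_order all_algebra.
From mathcomp Require Import finmap.
From mathcomp Require Import all_classical all_reals all_analysis.
From mathcomp Require Import measurable_realfun.
From mathcomp Require Import ring lra.
Import Order.TTheory GRing.Theory Num.Theory.
Import numFieldNormedType.Exports.
Set Implicit Arguments.
Unset Strict Implicit.
Unset Printing Implicit Defensive.
Local Open Scope classical_set_scope.
Local Open Scope ring_scope.

(** The space Xhat is the Gelfand spectrum of the algebra, and its weak* topology
is the coarsest one for which all the evaluations phi |-> phi f are continuous:
a filter converges to phi as soon as all evaluations converge along it
(cvg_XhatP).  Limits of characters along evaluations are characters, because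
the bound |phi f| <= |f| passes to the limit; hence Xhat is compact
(compact_Xhat), and it is Hausdorff since characters are determined by their
values.  Density of iota(X) rests on a spectral remark: if g >= 0 in the algebra
and phi g = 0, then g takes values below 1, for otherwise 1 - g / |g| would have
norm below 1 and still be sent to 1 by phi (char_fun_small).  Applied to sums of
squares of f - phi f, this produces points of X at which finitely many functions
are as close to phi as one wishes.  The metric for a separable algebra is read
off a dense sequence, and iota is an embedding exactly when convergence of all
the f in the algebra forces convergence in X, that is, when the algebra
generates the topology.

The image of the Gelfand transform separates the characters, so it is uniformly
dense in the continuous functions by the Stone-Weierstrass theorem
(stone_weierstrass).  That theorem is obtained from the approximation of the
absolute value by polynomials, which makes the uniform closure of an algebra a
lattice, and from a Dini argument on a compact space.

For the metric part, every f in the algebra becomes, after division by a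
positive constant, a competitor in the supremum that defines dhat.  So dhat
separates characters, all the functions Gamma f are dhat-Lipschitz, and dhat is
the supremum of |f phi - f psi| over any family of 1-Lipschitz functions that
contains Gamma of the competitors.

For the measure part, a finite Radon measure is concentrated on a countable
union C of compact sets.  Images of compact sets are compact, so iota(C) is
Borel, and for a Borel set E of X the set iota(E cap C) is Borel as well, by
injectivity.  This shows that iota(X) is measurable up to a null set, and that
a measurable function on X can be transported to Xhat almost everywhere, so that
the pull-back of L^p classes, a linear isometry, is onto; iota_star is its
inverse.  Uniqueness in L^p is a density statement: continuous functions are
dense in L^p of a Radon measure on a compact Hausdorff space
(Cb_dense_Lspace, by Urysohn functions and simple functions), and the image of
the Gelfand transform is uniformly dense among them. *)

(** * The Stone-Weierstrass theorem *)

Definition unif_approx {R : realType} {T : Type} (B : set (T -> R)) (f : T -> R) :=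
  forall e : R, 0 < e -> exists2 g, B g & forall x, `|f x - g x| <= e.

Lemma closure_unifP (R : realType) (T : topologicalType) (B : set (T -> R)) f :
  closure (B : set {uniform T -> R}) f <-> unif_approx B f.
Proof.
split=> [Bf e e0|Bf U].
  have /Bf [g [Bg /= fg]] :
      nbhs (f : {uniform T -> R}) [set g | forall x, ball (f x) e (g x)].
    apply/uniform_nbhs; exists [set xy : R * R | ball xy.1 e xy.2]; split=> //=.
      by rewrite -entourage_ballE; exists e.
    by move=> g fg x; exact: fg.
  by exists g => // x; exact: ltW (fg x).
move=> /uniform_nbhs[E [entE EU]].
have [e /= e0 eE] : exists2 e : R, 0 < e & [set xy : R * R | ball xy.1 e xy.2] `<=` E.
  by move: entE; rewrite -entourage_ballE => -[e /= e0 eE]; exists e.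
have [g Bg fg] := Bf (e / 2) (divr_gt0 e0 (ltr0n _ 2)).
exists g; split=> //; apply: EU => x _; apply: eE => /=.
by apply: (le_lt_trans (fg x)); rewrite ltr_pdivrMr// ltr_pMr// ltr1n.
Qed.

Lemma unif_approx_idem (R : realType) (T : Type) (B : set (T -> R)) :
  unif_approx (unif_approx B) `<=` unif_approx B.
Proof.
move=> f Bf e e0; have e20 : 0 < e / 2 by lra.
have [g Bg fg] := Bf _ e20; have [h Bh gh] := Bg _ e20.
exists h => // x; have -> : f x - h x = (f x - g x) + (g x - h x) by ring.
by apply: (le_trans (ler_normD _ _)); have := fg x; have := gh x; lra.
Qed.

Lemma sub_unif_approx {R : realType} {T : Type} (B : set (T -> R)) : B `<=` unif_approx B.
Proof. by move=> f Bf e e0; exists f => // x; rewrite subrr normr0 ltW. Qed.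

Lemma continuous_unif_approx (R : realType) (T : topologicalType) (B : set (T -> R)) f :
  (forall g, B g -> continuous g) -> unif_approx B f -> continuous f.
Proof.
move=> cB Bf x; apply/cvgrPdist_le => e e0; have e30 : 0 < e / 3 by lra.
have [g Bg fg] := Bf _ e30.
have /cvgrPdist_le /(_ _ e30) := cB g Bg x.
apply: filterS => y gxy; rewrite ler_norml.
have := fg x; have := fg y; move: gxy; rewrite !ler_norml; lra.
Qed.

(** A Dini argument for families that are directed downwards.  Near each point
some member of the family is below f, hence so are all the smaller members;
the neighbourhoods obtained along the filter of the small members cover the
compact space, so that all sufficiently small members are below f everywhere. *)
Lemma dini_directed (R : realType) (T : topologicalType) (D : set (T -> R)) (f : T -> R) :
  compact [set: T] -> D !=set0 ->
  (forall g h, D g -> D h -> D (fun x => Num.min (g x) (h x))) ->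
  (forall g, D g -> continuous g) -> continuous f ->
  (forall x, exists2 g, D g & g x < f x) ->
  exists2 g, D g & forall x, g x < f x.
Proof.
move=> /compact_near_coveringP cT [g0 Dg0] Dmin cD cf Df.
pose F : set_system (T -> R) :=
  filter_from D (fun h => [set g | D g /\ forall x, g x <= h x]).
have FF : ProperFilter F.
  apply: filter_from_proper; last by move=> h Dh; exists h.
  apply: filter_from_filter; first by exists g0.
  move=> g h Dg Dh; exists (fun x => Num.min (g x) (h x)); first exact: Dmin.
  by move=> k [Dk kgh]; split; split=> // x; have := kgh x; rewrite le_min => /andP[].
have /filter_ex [g [Dg gf]] : \forall g \near F, D g /\ [set: T] `<=` fun x => g x < f x.
  near=> g; split; first by near: g; exists g0 => // ? [].
  near: g; apply: (cT _ F (fun g x => g x < f x)) => x _.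
  have [h Dh hf] := Df x.
  exists ([set y | h y < f y], [set g | D g /\ forall x, g x <= h x]) => /=.
    split; last by exists h.
    have : (fun y => f y - h y) @ x --> f x - h x.
      by apply: cvgB; [exact: cf|exact: cD].
    move=> /cvgr_gt /(_ 0); rewrite subr_gt0 => /(_ hf).
    by apply: filterS => y; rewrite subr_gt0.
  by move=> [y g] /= [hfy [_ gh]]; exact: le_lt_trans (gh y) hfy.
by exists g => // x; exact: gf.
Unshelve. all: end_near. Qed.

(** Newton-like iteration u |-> u + (f^2 - u^2) / 2 for the square root of f^2:
its terms are polynomials in f without square roots, hence stay in any algebra
that contains f. *)
Fixpoint abs_iter {R : realType} {T : Type} (f : T -> R) n : T -> R :=
  if n is n'.+1 then
    fun x => abs_iter f n' x + 2^-1 * (f x * f x + (-1) * (abs_iter f n' x * abs_iter f n' x))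
  else fun=> 0.

Lemma abs_iter_algebra (R : realType) (T : Type) (B : set (T -> R)) f n :
  unital_subalgebra B -> B f -> B (abs_iter f n).
Proof.
move=> [B1 BD BZ BM] Bf; elim: n => /= [|n ih].
  rewrite (_ : (fun=> 0) = fun x => 0 * cst 1 x); first exact: BZ.
  by apply/funext => x; rewrite mul0r.
apply: (BD (abs_iter f n)) => //; apply/BZ/(BD (f \* f)); first exact: BM.
exact/BZ/(BM (abs_iter f n)).
Qed.

(** With t = |f x|, one step multiplies the error t - u by 1 - (t + u) / 2, which
is at most 1 - t / 2; the bound 2 t / (2 + k t) on the error after k steps is
what this contraction preserves, because (1 - t / 2) (2 + (k + 1) t) <= 2 + k t. *)
Lemma abs_iter_step (R : realType) (t u k : R) :
  0 <= t <= 1 -> 0 <= u <= t -> 0 <= k -> (t - u) * (2 + k * t) <= 2 * t ->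
  let v := u + 2^-1 * (t * t + (-1) * (u * u)) in
  0 <= v <= t /\ (t - v) * (2 + (k + 1) * t) <= 2 * t.
Proof.
move=> /andP[t0 t1] /andP[u0 ut] k0 le v.
have e : t - v = (t - u) * (1 - (t + u) / 2) by rewrite /v; field.
have tu : 0 <= t - u by lra.
split; [apply/andP; split|].
- apply: addr_ge0 => //; apply: mulr_ge0; first by rewrite invr_ge0.
  have -> : t * t + -1 * (u * u) = (t - u) * (t + u) by ring.
  by apply: mulr_ge0 => //; lra.
- by rewrite -subr_ge0 e; apply: mulr_ge0 => //; lra.
have c0 : 0 <= 2 + (k + 1) * t by apply: addr_ge0 => //; apply: mulr_ge0 => //; lra.
rewrite e -mulrA; apply: le_trans le; apply: ler_wpM2l => //.
apply: (@le_trans _ _ ((1 - t / 2) * (2 + (k + 1) * t))).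
  by apply: ler_wpM2r => //; lra.
have : 0 <= (k + 1) * (t * t) by apply: mulr_ge0; [lra|exact: mulr_ge0].
lra.
Qed.

Lemma abs_iter_bound (R : realType) (T : Type) (f : T -> R) x n : `|f x| <= 1 ->
  0 <= `|f x| - abs_iter f n x /\ n%:R * (`|f x| - abs_iter f n x) <= 2.
Proof.
set t : R := `|f x| => t1; have t0 : 0 <= t by exact: normr_ge0.
have ff : f x * f x = t * t by rewrite -normrM ger0_norm// -expr2 sqr_ge0.
suff : 0 <= abs_iter f n x <= t /\
    (t - abs_iter f n x) * (2 + n%:R * t) <= 2 * t.
  move=> [/andP[]]; set u : R := abs_iter f n x => u0 ut le.
  split; first by rewrite subr_ge0.
  have [t00|tn0] := eqVneq t 0.
    have -> : t - u = 0 by lra.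
    by rewrite mulr0.
  have tp : 0 < t by rewrite lt_def tn0.
  rewrite -(ler_pM2r tp); apply: le_trans le; rewrite -subr_ge0.
  have -> : (t - u) * (2 + n%:R * t) - n%:R * (t - u) * t = 2 * (t - u) by ring.
  by rewrite mulr_ge0// subr_ge0.
elim: n => [|n [ut le]]; first by rewrite /= lexx t0 subr0; split=> //; lra.
by have := @abs_iter_step _ t (abs_iter f n x) n%:R; rewrite -ff natr1; apply; rewrite ?t0.
Qed.

(** After division by a bound K of g, the iteration applies and its error 2 / n
does not depend on the point, so K u_n converges uniformly to |g|. *)
Lemma unif_approx_abs (R : realType) (T : Type) (B : set (T -> R)) f :
  unital_subalgebra B -> (forall g, B g -> exists M : R, forall x, `|g x| <= M) ->
  unif_approx B f -> unif_approx B (fun x => `|f x|).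
Proof.
move=> sB bB Bf; apply: unif_approx_idem => e e0; have [g Bg fg] := Bf _ e0.
exists (fun x => `|g x|); last first.
  by move=> x; apply: le_trans (fg x); exact: ler_dist_dist.
move=> {f Bf fg e e0} e e0; have [M gM] := bB _ Bg.
pose K := `|M| + 1; have K0 : 0 < K by rewrite /K; have := normr_ge0 M; lra.
have [_ _ BZ _] := sB.
pose n := (Num.truncn (2 * K / e)).+1.
have nK : 2 * K < n%:R * e by rewrite -ltr_pdivrMr// /n; exact: truncnS_gt.
have Bh : B (fun x => K^-1 * g x) by exact: BZ.
exists (fun x => K * abs_iter (fun x => K^-1 * g x) n x).
  by apply: BZ; exact: abs_iter_algebra.
move=> x.
have h1 : `|K^-1 * g x| <= 1.
  rewrite normrM gtr0_norm ?invr_gt0// ler_pdivrMl// mulr1.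
  by apply: (le_trans (gM x)); apply: (le_trans (ler_norm _)); rewrite /K; lra.
have -> : `|g x| = K * `|K^-1 * g x|.
  by rewrite normrM gtr0_norm ?invr_gt0// mulrA mulfV ?mul1r// gt_eqF.
have [] := @abs_iter_bound _ _ (fun x => K^-1 * g x) x n h1.
move: h1 (abs_iter _ _ _); set t : R := `|K^-1 * g x| => _ u tu le.
rewrite -mulrBr normrM (gtr0_norm K0) (ger0_norm tu).
have np : 0 < n%:R :> R by rewrite ltr0n.
by rewrite -(ler_pM2l np) mulrCA; nra.
Qed.

Section StoneWeierstrass.
Context {R : realType} {T : topologicalType} (B : set (T -> R)).
Hypotheses (cT : compact [set: T]) (Balg : unital_subalgebra B).
Hypotheses (BC : B `<=` @Cb R T).

Let bB g : B g -> exists M : R, forall x, `|g x| <= M.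
Proof.
move=> /BC[_ [M [_ gM]]]; exists (M + 1) => x.
by apply: gM => //; rewrite ltrDl.
Qed.

Let cB g : unif_approx B g -> continuous g.
Proof. by apply: continuous_unif_approx => h /BC[]. Qed.

Let unif_approxD f g : unif_approx B f -> unif_approx B g -> unif_approx B (fun x => f x + g x).
Proof.
have [_ BD _ _] := Balg.
move=> Bf Bg e e0; have e20 : 0 < e / 2 by lra.
have [f' Bf' ff'] := Bf _ e20; have [g' Bg' gg'] := Bg _ e20.
exists (f' \+ g'); first exact: BD.
move=> x /=; have := ff' x; have := gg' x; rewrite !ler_norml; lra.
Qed.

Let unif_approxZ a f : unif_approx B f -> unif_approx B (fun x => a * f x).
Proof.
have [_ _ BZ _] := Balg.
move=> Bf e e0; have a1 : 0 < `|a| + 1 by have := normr_ge0 a; lra.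
have [g Bg fg] := Bf _ (divr_gt0 e0 a1).
exists (fun x => a * g x); first exact: BZ.
move=> x; rewrite -mulrBr normrM.
apply: (@le_trans _ _ ((`|a| + 1) * (e / (`|a| + 1)))).
  by apply: ler_pM => //; rewrite lerDl.
by rewrite mulrC divfK// gt_eqF.
Qed.

Let unif_approx_min f g : unif_approx B f -> unif_approx B g ->
  unif_approx B (fun x => Num.min (f x) (g x)).
Proof.
move=> Bf Bg.
have -> : (fun x => Num.min (f x) (g x)) =
    (fun x => 2^-1 * ((f x + g x) + -1 * `|f x + -1 * g x|)).
  by apply/funext => x; rewrite !mulN1r mulrC; exact: minr_absE.
apply/unif_approxZ/unif_approxD; first exact: unif_approxD.
by apply/unif_approxZ/(@unif_approx_abs _ _ B (fun x => f x + -1 * g x)) => //; apply/unif_approxD => //; exact: unif_approxZ.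
Qed.

Hypothesis Bsep : forall x y, x <> y -> exists2 f, B f & f x <> f y.

Let interpolate x y a b : (x = y -> a = b) ->
  exists2 f, B f & f x = a /\ f y = b.
Proof.
have [B1 BD BZ _] := Balg => ab.
have BK c : B (fun x => c * cst 1 x) by exact: BZ.
have [exy|/eqP xy] := eqVneq x y.
  exists (fun x => a * cst 1 x) => //=.
  by rewrite mulr1; split=> //; exact: ab.
have [f Bf /eqP fxy] := Bsep xy.
have fxy0 : f x - f y != 0 by rewrite subr_eq0.
exists ((fun z => (a - b) / (f x - f y) * f z) \+
  (fun z => (b - (a - b) / (f x - f y) * f y) * cst 1 z)); first by apply: BD => //; exact: BZ.
by rewrite /=; split; field.
Qed.

(** The uniform closure is a lattice.  For each x, the members of the closure that
agree with f at x are directed under minima, which gives one of them that is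
below f + e everywhere.  The opposites of these functions are then used in the
same way to get a single function between f - e and f + e. *)
Theorem stone_weierstrass f : continuous f -> unif_approx B f.
Proof.
move=> cf; apply: unif_approx_idem => e e0.
have below x : exists2 g, unif_approx B g & g x = f x /\ forall z, g z < f z + e.
  have [g [Bg gx] gf] : exists2 g, unif_approx B g /\ g x = f x & forall z, g z < f z + e.
    apply: (@dini_directed R T [set g | unif_approx B g /\ g x = f x]) => //.
    - have [g Bg [gx _]] := interpolate (fun _ : x = x => erefl (f x)).
      by exists g; split=> //; exact: sub_unif_approx.
    - move=> g h [Bg gx] [Bh hx]; split; first exact: unif_approx_min.
      by rewrite gx hx minxx.
    - by move=> g [Bg _]; exact: cB.
    - by move=> y; apply: cvgD; [exact: cf|exact: cvg_cst].
    - move=> y; have [g Bg [gx gy]] := interpolate (fun e : x = y => congr1 f e).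
      exists g; last by rewrite gy ltrDl.
      by split=> //; exact: sub_unif_approx.
  by exists g.
have uN g : unif_approx B g -> unif_approx B (fun x => - g x).
  rewrite (_ : (fun x => - g x) = fun x => -1 * g x); first exact: unif_approxZ.
  by apply/funext => x; rewrite mulN1r.
have [g [Bg gf] fg] : exists2 g, unif_approx B g /\ (forall z, - g z < f z + e) &
    forall z, g z < - f z + e.
  apply: (@dini_directed R T [set g | unif_approx B g /\ forall z, - g z < f z + e]).
  - exact: cT.
  - have [[x _]|T0] := pselect (exists x : T, True).
      have [g Bg [_ gf]] := below x.
      by exists (fun x => - g x); split=> [|z]; [exact: uN|rewrite opprK].
    have [B1 _ _ _] := Balg.
    exists (cst 1); split; first exact: sub_unif_approx.
    by move=> z; case: T0; exists z.
  - move=> g h [Bg gf] [Bh hf]; split; first exact: unif_approx_min.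
    by move=> z; rewrite ltrNl lt_min; apply/andP; split; rewrite ltrNl.
  - by move=> g [Bg _]; exact: cB.
  - move=> x; apply: cvgD; last exact: cvg_cst.
    by apply: cvgN; exact: cf.
  - move=> x; have [g Bg [gx gf]] := below x.
    exists (fun x => - g x); last by rewrite gx ltrDl.
    by split=> [|z]; [exact: uN|rewrite opprK].
exists (fun x => - g x); first exact: uN.
by move=> x; have := gf x; have := fg x; rewrite ler_norml; lra.
Qed.
End StoneWeierstrass.

(** * Convergence in initial topologies *)

Lemma cvg_initialP (S : choiceType) (T : topologicalType) (f : S -> T)
    (F : set_system S) (s : S) : Filter F ->
  F --> (s : initial_topology f) <-> f @ F --> f s.
Proof.
move=> FF; split=> [Fs|Fs U].
  by apply: cvg_comp Fs _; exact: initial_continuous.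
move=> [_ [[B oB <-] Bs BU]]; apply: (filterS BU).
by apply: Fs; exact: open_nbhs_nbhs.
Qed.

Lemma cvg_family_initialP (R : realType) (X : choiceType) (B : set (X -> R))
    (F : set_system X) (x : X) : Filter F ->
  F --> (x : family_initial_topology B) <-> forall f, B f -> f @ F --> f x.
Proof.
move=> FF; split=> [/cvg_sup Fx f Bf|Fx].
  exact: (cvg_initialP (f : X -> R) x FF).1 (Fx (exist _ f (mem_set Bf))).
apply/cvg_sup => -[f fB].
exact: (cvg_initialP (f : X -> R) x FF).2 (Fx f (set_mem fB)).
Qed.

(** The initial topology as the property used below: convergence along all the
functions of the family implies convergence. *)
Lemma generates_topologyP (R : realType) (X : topologicalType) (B : set (X -> R)) :
  generates_topology B <->
  (forall f, B f -> continuous f) /\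
  (forall (F : set_system X) x, Filter F ->
     (forall f, B f -> f @ F --> f x) -> F --> x).
Proof.
pose Y := family_initial_topology B.
have YB f : B f -> continuous (f : Y -> R).
  move=> Bf x; apply: (cvg_family_initialP B (x : X) (nbhs_filter (x : Y))).1 => //.
split=> [XY|[cB FB] U]; last first.
  split=> [oU|oU]; rewrite openE => x Ux.
    have : nbhs (x : X) `<=` nbhs (x : Y).
      by apply: (FB _ _ (nbhs_filter (x : Y))) => f Bf; exact: YB.
    by apply; exact: open_nbhs_nbhs.
  have : nbhs (x : Y) `<=` nbhs (x : X).
    by apply/cvg_family_initialP => f Bf; exact: cB.
  by apply; exact: (@open_nbhs_nbhs Y).
split=> [f Bf|F x FF Fx].
  apply/continuousP => V oV; apply/XY.
  by move/YB : Bf => /continuousP; exact.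
move=> U; rewrite nbhsE => -[V [oV Vx] VU]; apply: (filterS VU).
have := (cvg_family_initialP B x FF).2 Fx; apply.
by apply: (@open_nbhs_nbhs Y); split=> //; exact/XY.
Qed.

(** * The spectrum: compactness, density of the points, embedding *)

Section GelfandSpectrum.
Context {R : realType} {X : ptopologicalType} {d : X -> X -> \bar R}.
Variable A : compat_algebra d.

Lemma alg_fun0 x : alg_fun (0 : alg A) x = 0. Proof. by []. Qed.
Lemma alg_fun1 x : alg_fun (1 : alg A) x = 1. Proof. by []. Qed.
Lemma alg_funD (f g : alg A) x : alg_fun (f + g) x = f x + g x. Proof. by []. Qed.
Lemma alg_funB (f g : alg A) x : alg_fun (f - g) x = f x - g x. Proof. by []. Qed.
Lemma alg_funM (f g : alg A) x : alg_fun (f * g) x = f x * g x. Proof. by []. Qed.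
Lemma alg_funZ a (f : alg A) x : alg_fun (a *: f) x = a * f x. Proof. by []. Qed.
Definition alg_funE :=
  (alg_fun0, alg_fun1, alg_funB, alg_funD, alg_funM, alg_funZ).

Lemma cvg_XhatP (F : set_system (Xhat A)) (phi : Xhat A) : Filter F ->
  F --> phi <-> forall f, char_fun psi f @[psi --> F] --> char_fun phi f.
Proof.
move=> FF; split=> [Fphi f|Fphi].
  exact: (cvg_comp _ _ Fphi (@char_fun_continuous _ _ _ A f phi)).
apply/(cvg_initialP (val : Xhat A -> dual_space A)).
apply/(cvg_initialP (@dual_fun _ _ _ A)).
by apply/(@pointwise_cvgP (alg A) R^o) => f; exact: Fphi.
Qed.

Lemma char_fun_inj (phi psi : Xhat A) : char_fun phi =1 char_fun psi -> phi = psi.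
Proof.
move=> e; do 2!apply: val_inj.
have {e} : (val (val phi) : alg A -> R^o) = val (val psi) by apply/funext.
case: (val (val phi)) => f cf; case: (val (val psi)) => g cg /= fg.
move: cf cg; rewrite fg => -[[a1] [a2]] [[b1] [b2]].
by rewrite (Prop_irrelevance a1 b1) (Prop_irrelevance a2 b2).
Qed.

Lemma char_funD (phi : Xhat A) f g :
  char_fun phi (f + g) = char_fun phi f + char_fun phi g.
Proof. exact: (linearD (val (val phi))). Qed.

Lemma char_funM (phi : Xhat A) f g :
  char_fun phi (f * g) = char_fun phi f * char_fun phi g.
Proof. by have [_] := set_mem (valP phi); exact. Qed.

(** The bound |l f| <= |f| makes a linear form continuous, which is the only
analytic content of being a character. *)
Lemma char_fun_ex (l : alg A -> R^o) : linear l ->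
  (forall f g, l (f * g) = l f * l g) -> l 1 = 1 -> (forall f, `|l f| <= `|f|) ->
  exists phi : Xhat A, char_fun phi =1 l.
Proof.
move=> lin lM l1 lb.
pose L : {linear alg A -> R^o} := HB.pack l (GRing.isLinear.Build R (alg A) R^o *:%R l lin).
have cL : continuous L.
  move=> f; apply/(@cvgrPdist_lt _ _ _ (nbhs f)) => e e0.
  apply: filterS (nbhsx_ballx f e e0) => g; rewrite -ball_normE /= => fg.
  by rewrite -[l f - l g](linearB L); exact: le_lt_trans (lb _) fg.
pose psi : dual_space A := exist _ L (mem_set cL).
have cpsi : character psi by split=> //; exists 1; apply/eqP; rewrite [dual_fun _ _]l1 oner_neq0.
by exists (exist _ psi (mem_set cpsi)).
Qed.

Lemma hausdorff_Xhat : hausdorff_space (Xhat A).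
Proof.
move=> phi psi; rewrite cluster_cvgE => -[G GG [Gpsi phiG]].
apply: char_fun_inj => f.
have h2 := (cvg_XhatP phi GG).1 phiG f.
have h1 := (cvg_XhatP psi GG).1 Gpsi f.
exact: (cvg_unique (@Rhausdorff R) h2 h1).
Qed.

Lemma char_fun_limit (F : set_system (Xhat A)) (l : alg A -> R^o) : ProperFilter F ->
  (forall f, char_fun psi f @[psi --> F] --> l f) ->
  exists phi : Xhat A, char_fun phi =1 l.
Proof.
move=> FF Fl.
have lE f a : char_fun psi f @[psi --> F] --> a -> l f = a.
  by move=> Fa; exact: (cvg_unique (@Rhausdorff R) (Fl f) Fa).
apply: char_fun_ex.
- move=> a f g; apply: lE.
  under eq_cvg do rewrite char_funD char_funZ.
  by apply: cvgD => //; apply: cvgM => //; exact: cvg_cst.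
- by move=> f g; apply: lE; under eq_cvg do rewrite char_funM; exact: cvgM.
- by apply: lE; under eq_cvg do rewrite char_fun1; exact: cvg_cst.
- move=> f; have /cvg_norm Ff := Fl f.
  apply: (cvgr_to_le Ff).
  by apply: nearW => psi; exact: char_fun_le.
Qed.

(** An ultrafilter converges along each evaluation, since the evaluation at f takes
its values in the segment [-|f|, |f|]; the limits form a character. *)
Lemma compact_Xhat : compact [set: Xhat A].
Proof.
rewrite compact_ultra => F UF _; have PF : ProperFilter F by exact: ultra_proper.
have Fcvg f : exists l : R, char_fun psi f @[psi --> F] --> l.
  have [|l [_ Fl]] := @segment_compact R (- `|f|) `|f| (char_fun psi f @[psi --> F]) (fmap_proper_filter _ PF).
    by apply: (@filterE _ F) => psi; rewrite /= in_itv /= -ler_norml; exact: char_fun_le.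
  exists l => V lV; have [//|FV] := in_ultra_setVsetC ((char_fun (A := A))^~ f @^-1` V) UF.
  by have [y []] := Fl (~` V) V FV lV.
have [l Fl] := choice Fcvg.
have [phi phil] := char_fun_limit PF Fl.
exists phi; split=> //; apply/cvg_XhatP => f.
by rewrite phil; exact: Fl.
Qed.

(** If g >= 1 held everywhere, h = 1 - g / |g| would satisfy |h| <= 1 - 1 / |g| < 1
although phi h = 1. *)
Lemma char_fun_small (phi : Xhat A) (g : alg A) :
  (forall x, 0 <= g x) -> char_fun phi g = 0 -> exists x, g x < 1.
Proof.
move=> g0 pg; apply: contrapT => /forallNP g1.
have {}g1 x : 1 <= g x by rewrite leNgt; exact/negP.
pose M : R := `|g|.
have gM x : g x <= M by apply: le_trans (ler_norm _) (le_supnorm g x).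
have M1 : 1 <= M by exact: le_trans (g1 point) (gM point).
have M0 : 0 < M by lra.
have : `|1 - M^-1 *: g| <= 1 - M^-1.
  apply: supnorm_le => [|x]; first by rewrite subr_ge0 invf_le1.
  rewrite !alg_funE ger0_norm.
    have Mi : 0 < M^-1 by rewrite invr_gt0.
    by rewrite lerD2l lerN2 ler_peMr ?(ltW Mi)//; exact: g1.
  by rewrite subr_ge0 mulrC ler_pdivrMr// mul1r.
apply/negP; rewrite -ltNge.
apply: lt_le_trans (char_fun_le phi _).
rewrite char_funB char_funZ pg char_fun1 mulr0 subr0 normr1.
by rewrite ltrBlDr ltrDl invr_gt0.
Qed.

(** The sets where g < 1, for g >= 0 with phi g = 0, form a filter base on X: they
are nonempty by char_fun_small, and the intersection of two of them contains the
one given by the sum.  Taking for g the square of (f - phi f) / e shows that iota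
converges to phi along this filter. *)
Lemma dense_iota : dense (range (iotaX A)).
Proof.
move=> O [phi Ophi] oO.
pose D : set (alg A) := [set g : alg A | (forall x, 0 <= g x) /\ char_fun phi g = 0].
pose G : set_system X := filter_from D (fun g : alg A => [set x | g x < 1]).
have GG : ProperFilter G.
  apply: filter_from_proper; last by move=> g [g0 pg]; exact: char_fun_small pg.
  apply: filter_from_filter.
    exists 0; split=> [x|]; first by rewrite alg_fun0.
    exact: (linear0 (val (val phi))).
  move=> g h [g0 pg] [h0 ph]; exists (g + h).
    split=> [x|]; first by rewrite !alg_funE addr_ge0.
    by rewrite char_funD pg ph addr0.
  move=> x; rewrite /= !alg_funE => gh1.
  by split; apply: le_lt_trans gh1; rewrite ?lerDl ?lerDr.
have : iotaX A x @[x --> G] --> phi.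
  apply/cvg_XhatP => f; apply/cvgrPdist_lt => e e0 /=.
  pose k : alg A := e^-1 *: (f - char_fun phi f *: (1 : alg A)).
  have kE x : k x = e^-1 * (f x - char_fun phi f).
    by rewrite !alg_funE mulr1.
  exists (k * k).
    split=> [x|]; first by rewrite !alg_funE -expr2 sqr_ge0.
    by rewrite char_funM char_funZ char_funB char_funZ char_fun1 mulr1 subrr !mulr0.
  move=> x /= k1; have {k1} : alg_fun (k * k) x < 1 by [].
  rewrite alg_funM kE -expr2 => k1.
  rewrite char_fun_iota distrC -ltr_sqr ?nnegrE ?(ltW e0)// real_normK ?num_real//.
  move: k1; rewrite exprMn exprVn mulrC ltr_pdivrMr ?mul1r//.
  by rewrite exprn_gt0.
move=> /(_ O (open_nbhs_nbhs (conj oO Ophi))).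
move=> /(@filter_ex _ G _) [x Ox]; exists (iotaX A x); split=> //.
Qed.

Definition to_alg f (Af : alg_set A f) : alg A := exist _ (f : X -> R^o) (mem_set Af).

Lemma char_fun_to_alg_iota f (Af : alg_set A f) x :
  char_fun (iotaX A x) (to_alg Af) = f x.
Proof. by []. Qed.

(** Convergence of iota(z) to iota(x) is convergence of f z to f x for all f in the
algebra, so continuity of the inverse on the image says that these convergences
imply that of z to x. *)
Lemma homeo_onto_imageP : injective (iotaX A) ->
  homeo_onto_image (iotaX A) <-> generates_topology (alg_set A).
Proof.
move=> inj; rewrite generates_topologyP; split.
  move=> [_ [g [gK /subspace_continuousP cg]]]; split.
    move=> f Af; exact: (alg_Cb (to_alg Af)).1.
  move=> F x FF Fx U xU.
  have Fi : iotaX A z @[z --> F] --> iotaX A x.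
    by apply/cvg_XhatP => f; exact: Fx (alg_funP f).
  have rx : range (iotaX A) (iotaX A x) by exists x.
  have gU : nbhs (g (iotaX A x)) U by rewrite gK.
  apply: (@filterS _ F _ _ _ _ (Fi _ (cg _ rx U gU))) => z /= Uz.
  by rewrite -(gK z); apply: Uz; exists z.
move=> [_ FA]; split; first exact: iota_continuous.
pose g y := xget point [set x | iotaX A x = y].
have gK : cancel (iotaX A) g.
  by move=> x; apply: inj; apply: (@xgetPex _ point [set z | iotaX A z = iotaX A x]); exists x.
exists g; split=> //; apply/subspace_continuousP => _ [x _ <-].
suff : g y @[y --> within (range (iotaX A)) (nbhs (iotaX A x))] --> x.
  by rewrite (gK x : from_subspace (range (iotaX A)) g (iotaX A x) = x).
apply: FA => f Af V fV.
have := @char_fun_continuous _ _ _ A (to_alg Af) (iotaX A x) V fV.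
apply: (@filterS _ (nbhs (iotaX A x))) => y /= Vy [z _ zy].
by move: Vy; rewrite -zy gK.
Qed.

(** Since |phi h - phi k| <= |h - k| on the algebra, the values phi h form a Cauchy
filter as h tends to f uniformly.  The extension thus exists, and inherits the
same contraction property. *)
Lemma char_ext_dist (phi : Xhat A) f (g : alg A) e : uclosure A f ->
  (forall x, `|f x - g x| <= e) -> `|Gamma A f phi - char_fun phi g| <= e.
Proof.
move=> Af fg.
pose F := within (alg_set A) (nbhs (f : {uniform X -> R})).
have FF : ProperFilter F by apply: (@within_nbhs_proper {uniform X -> R}).
pose H (h : {uniform X -> R}) : R := oapp (char_fun phi) 0 (insub (h : X -> R^o)).
have Hdist (h : alg A) (k : X -> R) c : alg_set A k ->
    (forall x, `|k x - h x| <= c) -> `|H k - char_fun phi h| <= c.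
  move=> Ak kh; rewrite /H insubT /=; first exact: mem_set.
  move=> Ak'; rewrite -char_funB; apply: le_trans (char_fun_le _ _) _.
  apply: supnorm_le => [|x]; last exact: kh.
  exact: le_trans (normr_ge0 _) (kh point).
have nearF c : 0 < c -> \forall k \near F, forall x, `|f x - k x| <= c.
  move=> c0; apply: cvg_within; apply/uniform_nbhs.
  exists [set xy : R * R | ball xy.1 c xy.2]; split.
    by rewrite -entourage_ballE; exists c.
  by move=> k fk x; apply: ltW; exact: fk.
have nearA : \forall k \near F, alg_set A k by exact: withinT.
have HF : cvg (H @ F).
  apply/cauchy_cvgP/cauchy_exP => c c0; have c20 : 0 < c / 2 by lra.
  have /filter_ex [k [Ak fk]] : \forall k \near F, alg_set A k /\ forall x, `|f x - k x| <= c / 4.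
    by apply: filterI => //; apply: nearF; lra.
  exists (char_fun phi (to_alg Ak)).
  have : \forall h \near F, alg_set A h /\ forall x, `|f x - h x| <= c / 4.
    by apply: filterI => //; apply: nearF; lra.
  apply: filterS => h [Ah fh]; rewrite /= -ball_normE /= distrC.
  apply: (@le_lt_trans _ _ (c / 2)); last by lra.
  apply: Hdist => // x; have := fk x; have := fh x.
  by change (`|f x - h x| <= c / 4 -> `|f x - k x| <= c / 4 -> `|h x - k x| <= c / 2); rewrite !ler_norml; lra.
apply/ler_addgt0Pr => c c0; have c20 : 0 < c / 2 by lra.
have /filter_ex [k [Ak fk Hk]] : \forall k \near F,
    [/\ alg_set A k, forall x, `|f x - k x| <= c / 2 & `|lim (H @ F) - H k| < c / 2].
  near=> k; split; near: k; [exact: nearA|exact: nearF|].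
  by move/cvgrPdist_lt: HF; exact.
have : `|H k - char_fun phi g| <= e + c / 2.
  apply: Hdist => // x; have -> : k x - g x = (f x - g x) - (f x - k x) by ring.
  by apply: (le_trans (ler_normB _ _)); exact: lerD.
have -> : Gamma A f phi - char_fun phi g =
    (lim (H @ F) - H k) + (H k - char_fun phi g) by rewrite addrA subrK.
by move=> /(lerD (ltW Hk)) /(le_trans (ler_normD _ _)) /le_trans; apply; lra.
Unshelve. all: end_near. Qed.

End GelfandSpectrum.

(** * Lipschitz constants and finite suprema *)

Section LipschitzConstant.
Context {R : realType} {T : Type} (d : T -> T -> \bar R).

Lemma Lip_le (f : T -> R) (K : \bar R) : (0 <= K)%E ->
  (forall x y, (`|f x - f y|%:E <= K * d x y)%E) -> (Lip f [set: T] d <= K)%E.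
Proof. by move=> K0 fK; apply: ereal_inf_lbound; split. Qed.

(** The infimum in the Lipschitz constant is approached by constants L that are at
most K + e / (r + 1), where r is the distance of x and y; this costs at most e.
Positivity of K settles the pairs at infinite distance. *)
Lemma le_Lip_dist (f : T -> R) (K : R) x y : (forall x y, (0 <= d x y)%E) ->
  0 < K -> (Lip f [set: T] d <= K%:E)%E -> (`|f x - f y|%:E <= K%:E * d x y)%E.
Proof.
move=> d0 K0 fK; move: (d0 x y); case dxy : (d x y) => [r| |//] r0; last first.
  by rewrite gt0_muley// leey.
rewrite lee_fin in r0; rewrite -EFinM lee_fin; apply/ler_addgt0Pr => e e0.
have r1 : 0 < r + 1 by lra.
have : (Lip f [set: T] d < (K + e / (r + 1))%:E)%E.
  by apply: le_lt_trans fK _; rewrite lte_fin ltrDl divr_gt0.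
move=> /ereal_inf_lt [[L| |] [L0 fL] //]; rewrite lte_fin => LK.
have := fL x y I I; rewrite dxy -EFinM lee_fin => /le_trans; apply.
apply: (@le_trans _ _ ((K + e / (r + 1)) * r)); first by rewrite ler_wpM2r// ltW.
rewrite mulrDl lerD2l -mulrA -[leRHS]mulr1 ler_pM2l//.
by rewrite mulrC ler_pdivrMr// mul1r lerDl.
Qed.

Lemma Lip_fin (f : T -> R) : (Lip f [set: T] d < +oo)%E ->
  exists2 K : R, 0 < K & (Lip f [set: T] d <= K%:E)%E.
Proof.
move=> fy; exists (`|fine (Lip f [set: T] d)| + 1).
  by have := normr_ge0 (fine (Lip f [set: T] d)); lra.
have : (0 <= Lip f [set: T] d)%E by apply: le_ereal_inf_tmp => L [].
case: (Lip f [set: T] d) fy => [r _ r0| |//]//=; rewrite lee_fin.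
by have := ler_norm r; lra.
Qed.

Lemma Lip_scale (f : T -> R) (K : R) : (forall x y, (0 <= d x y)%E) ->
  0 < K -> (Lip f [set: T] d <= K%:E)%E ->
  (Lip (fun x => (K^-1 * f x)%R) [set: T] d <= 1)%E.
Proof.
move=> d0 K0 fK; apply: Lip_le => // x y; rewrite mul1e.
rewrite -mulrBr normrM gtr0_norm ?invr_gt0// EFinM lee_pdivrMl//.
exact: le_Lip_dist.
Qed.

End LipschitzConstant.

Section FiniteSup.
Context {R : realType} {I : choiceType}.
Implicit Types (i : set I) (u : I -> R).

Lemma finite_image_ubound i u : finite_set i -> exists M, forall k, i k -> u k <= M.
Proof.
move=> /finite_fsetP[D ->]; exists (\big[Num.max/0]_(k <- D) u k) => k /= kD.
by apply: le_bigmax_seq.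
Qed.

Lemma le_finite_sup i u k : finite_set i -> i k -> u k <= sup [set u k | k in i].
Proof.
move=> /(finite_image_ubound u)[M uM] ik; apply: ub_le_sup; last by exists k.
by exists M => _ [l il <-]; exact: uM.
Qed.

Lemma ge0_sup_le i u c : 0 <= c -> (forall k, i k -> u k <= c) ->
  sup [set u k | k in i] <= c.
Proof.
move=> c0 uc; have [->|/set0P ne] := eqVneq [set u k | k in i] set0.
  by rewrite sup0.
by apply: ge_sup => // _ [k ik <-]; exact: uc.
Qed.

Lemma finite_sup_ge0 i u : finite_set i -> (forall k, 0 <= u k) ->
  0 <= sup [set u k | k in i].
Proof.
move=> fi u0; have [->|/set0P[k ik]] := eqVneq i set0.
  by rewrite image_set0 sup0.
by apply: le_trans (u0 k) _; exact: le_finite_sup.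
Qed.

End FiniteSup.

(** * The compactification: Gelfand transform, metrizability, distances *)

Section GelfandCompactification.
Context {R : realType} {X : ptopologicalType} {d : X -> X -> \bar R}.
Variable A : compat_algebra d.

Definition gelfand (f : alg A) : Xhat A -> R := fun phi => char_fun phi f.

Lemma GammaP g : (Gamma A @` A) g <-> exists f : alg A, g = gelfand f.
Proof.
split=> [[f Af <-]|[f ->]].
  by exists (to_alg Af); apply/funext => phi; exact: (GammaE (to_alg Af)).
by exists f; [exact: alg_funP|apply/funext => phi; exact: GammaE].
Qed.

Lemma Gamma_image_Cb : Gamma A @` A `<=` @Cb R (Xhat A).
Proof. by move=> _ [f Af <-]; exact: (Gamma_Cb (to_alg Af)). Qed.

Lemma Gamma_unital_subalgebra : unital_subalgebra (Gamma A @` A).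
Proof.
split.
- by apply/GammaP; exists 1; apply/funext => phi; rewrite /gelfand char_fun1.
- move=> _ _ /GammaP[f ->] /GammaP[g ->]; apply/GammaP; exists (f + g).
  by apply/funext => phi; rewrite /gelfand char_funD.
- move=> a _ /GammaP[f ->]; apply/GammaP; exists (a *: f).
  by apply/funext => phi; rewrite /gelfand char_funZ.
- move=> _ _ /GammaP[f ->] /GammaP[g ->]; apply/GammaP; exists (f * g).
  by apply/funext => phi; rewrite /gelfand char_funM.
Qed.

Lemma Gamma_iota_image : [set g \o iotaX A | g in Gamma A @` A] = A.
Proof.
apply/seteqP; split=> [_ [_ /GammaP[f ->] <-]|f Af]; first exact: (alg_funP f).
exists (Gamma A f); first by exists f.
by apply/funext => x; exact: (GammaE (to_alg Af)).
Qed.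

Lemma unif_approx_Gamma f : uclosure A f -> unif_approx (Gamma A @` A) (Gamma A f).
Proof.
move=> Af e e0; have /closure_unifP /(_ e e0)[g Ag fg] := Af.
exists (gelfand (to_alg Ag)); first by apply/GammaP; exists (to_alg Ag).
by move=> phi; exact: char_ext_dist.
Qed.

Lemma Gamma_uclosure_Cb f : uclosure A f -> @Cb R (Xhat A) (Gamma A f).
Proof.
move=> Af; split.
  by apply: continuous_unif_approx (unif_approx_Gamma Af) => g /Gamma_image_Cb[].
have [_ /GammaP[g ->] fg] := unif_approx_Gamma Af ltr01.
exists (`|g| + 1); split; first exact: num_real.
move=> M gM phi _ /=; apply: le_trans (ltW gM).
have -> : Gamma A f phi = char_fun phi g + (Gamma A f phi - char_fun phi g) by ring.
by apply: le_trans (ler_normD _ _) _; apply: lerD => //; exact: char_fun_le.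
Qed.

Lemma Gamma_iota f : uclosure A f -> Gamma A f \o iotaX A = f.
Proof.
move=> Af; apply/funext => x; apply/eqP; rewrite -subr_eq0 -normr_le0.
apply/ler_addgt0Pr => e e0; rewrite add0r; have e20 : 0 < e / 2 by lra.
have /closure_unifP /(_ _ e20)[g Ag fg] := Af.
have -> : (Gamma A f \o iotaX A) x - f x =
  (Gamma A f (iotaX A x) - char_fun (iotaX A x) (to_alg Ag)) - (f x - g x).
  by rewrite char_fun_to_alg_iota /=; ring.
apply: le_trans (ler_normB _ _) _; rewrite [leRHS](splitr e).
by apply: lerD => //; exact: char_ext_dist.
Qed.

(** Two continuous functions differ on an open set, which would meet the dense
image of X. *)
Lemma eq_on_iota (f g : Xhat A -> R) : continuous f -> continuous g ->
  f \o iotaX A = g \o iotaX A -> f = g.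
Proof.
move=> cf cg fg; apply/funext => phi; apply/eqP; rewrite -subr_eq0.
apply/negPn/negP => fg0.
have : open [set psi : Xhat A | f psi - g psi != 0].
  apply: (@open_comp _ _ (fun psi => f psi - g psi) [set r | r != 0]).
    by move=> psi _; exact: (@continuousB R R (Xhat A) f g psi (cf psi) (cg psi)).
  exact: open_neq.
move=> /dense_iota []; first by exists phi.
by move=> _ [/= /[swap] -[x _ <-]]; rewrite -[f _]/((f \o iotaX A) x) fg subrr eqxx.
Qed.

Lemma Gamma_uniformly_dense f : continuous f -> unif_approx (Gamma A @` A) f.
Proof.
apply: stone_weierstrass.
- exact: compact_Xhat.
- exact: Gamma_unital_subalgebra.
- exact: Gamma_image_Cb.
- move=> phi psi phipsi; apply: contrapT => /forall2NP sep; apply: phipsi.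
  apply: char_fun_inj => g; have [[]|/contrapT//] := sep (gelfand g).
  by apply/GammaP; exists g.
Qed.


Section Metrization.
Variable u : nat -> alg A.
Hypothesis du : dense (range u).

Let w n (phi psi : Xhat A) : R :=
  Num.min n.+1%:R^-1 `|char_fun phi (u n) - char_fun psi (u n)|.
Let rho phi psi : R := sup (range (fun n => w n phi psi)).

Let w_le_rho n phi psi : w n phi psi <= rho phi psi.
Proof.
apply: ub_le_sup; last by exists n.
exists 1 => _ [k _ <-]; rewrite ge_min; apply/orP; left.
by rewrite invf_le1// ler1n.
Qed.

Let rho_le phi psi c : (forall n, w n phi psi <= c) -> rho phi psi <= c.
Proof. by move=> wc; apply: ge_sup; [exists (w 0 phi psi), 0|move=> _ [n _ <-]]. Qed.

Let w_ge0 n phi psi : 0 <= w n phi psi.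
Proof. by rewrite le_min invr_ge0 ler0n normr_ge0. Qed.

(** If u n is within e / 3 of f, then rho < min (1 / (n + 1), e / 3) forces
|phi (u n) - psi (u n)| < e / 3. *)
Let rho_close f e : 0 < e -> exists2 c : R, 0 < c &
  forall phi psi, rho phi psi < c -> `|char_fun phi f - char_fun psi f| < e.
Proof.
move=> e0; have e30 : 0 < e / 3 by lra.
have [g [/= + [n _ ng]]] : ball f (e / 3)  `&` range u !=set0.
  apply: du; last exact: ball_open.
  by exists f; exact: ballxx.
rewrite -ng -ball_normE /= => fu.
exists (Num.min n.+1%:R^-1 (e / 3)) => [|phi psi].
  by rewrite lt_min invr_gt0 ltr0n e30.
move=> /(le_lt_trans (w_le_rho n phi psi)); rewrite lt_min !gt_min ltxx /=.
move=> /andP[hn hc]; have {hn hc} h : `|char_fun phi (u n) - char_fun psi (u n)| < e / 3.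
  by case/orP: hc => // /(lt_trans hn).
have -> : char_fun phi f - char_fun psi f = char_fun phi (f - u n) +
    (char_fun phi (u n) - char_fun psi (u n)) - char_fun psi (f - u n).
  by rewrite !char_funB; ring.
apply: (le_lt_trans (ler_normB _ _)).
have -> : e = (e / 3 + e / 3) + e / 3 by field.
apply: ltrD; last exact: le_lt_trans (char_fun_le _ _) fu.
apply: (le_lt_trans (ler_normD _ _)); apply: ltrD h.
exact: le_lt_trans (char_fun_le _ _) fu.
Qed.

(** The distance is the supremum over n of min (1 / (n + 1), |phi (u n) - psi (u n)|).
Its balls are neighbourhoods because only the finitely many n with
1 / (n + 1) > e / 2 impose a condition, and they converge to their center by
rho_close. *)
Lemma metrizable_dense_sequence : metrizable R (Xhat A).
Proof.
exists rho; split.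
- move=> phi psi; split=> [r0|->]; last first.
    apply/eqP; rewrite eq_le (le_trans (w_ge0 0 psi psi))// andbT.
    by apply: rho_le => n; rewrite /w subrr normr0 ge_min lexx orbT.
  apply: char_fun_inj => f; apply/eqP; rewrite -subr_eq0 -normr_le0.
  apply/ler_addgt0Pr => e e0; rewrite add0r.
  have [c c0 rc] := rho_close f e0.
  by apply/ltW/rc; rewrite r0.
- move=> phi psi; congr sup; congr image; apply/funext => n.
  by rewrite /w distrC.
- move=> phi psi chi; apply: rho_le => n.
  apply: le_trans (lerD (w_le_rho n phi psi) (w_le_rho n psi chi)).
  rewrite /w; have := ler_distD (char_fun psi (u n)) (char_fun phi (u n)) (char_fun chi (u n)).
  set a : R := `|_ - _|; set b : R := `|_ - _|; set c : R := `|_ - _| => abc.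
  have n0 : 0 <= n.+1%:R^-1 :> R by rewrite invr_ge0.
  have [b0 c0] : 0 <= b /\ 0 <= c by rewrite /b /c !normr_ge0.
  have [h1|h1] := leP b n.+1%:R^-1; have [h2|h2] := leP c n.+1%:R^-1.
  + by rewrite ge_min; apply/orP; right.
  + by rewrite ge_min; apply/orP; left; rewrite lerDr.
  + by rewrite ge_min; apply/orP; left; rewrite lerDl.
  + by rewrite ge_min; apply/orP; left; rewrite lerDl.
- move=> phi U; split=> [phiU|[e e0 eU]].
    pose F : set_system (Xhat A) :=
      filter_from [set e : R | 0 < e] (fun e => [set psi | rho phi psi < e]).
    have FF : Filter F.
      apply: filter_from_filter; first by exists 1; exact: ltr01.
      move=> a b a0 b0; exists (Num.min a b); first by rewrite /= lt_min a0.
      by move=> psi /=; rewrite lt_min => /andP[].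
    suff : F --> phi by move=> /(_ U phiU)[e e0 eU]; exists e.
    apply/cvg_XhatP => f; apply/cvgrPdist_lt => e e0.
    by have [c c0 rc] := rho_close f e0; exists c => // psi /rc.
  have e20 : 0 < e / 2 by lra.
  pose N := (Num.truncn (e / 2)^-1).+1.
  have NP : \forall psi \near phi, forall n : 'I_N,
      `|char_fun phi (u n) - char_fun psi (u n)| < e / 2.
    apply: (filter_forall (nbhs_filter phi)) => n.
    by have /cvgrPdist_lt := @char_fun_continuous _ _ _ A (u n) phi; exact.
  apply: filterS NP => psi psiN; apply: eU => /=.
  apply: (@le_lt_trans _ _ (e / 2)); last by lra.
  apply: rho_le => n; rewrite ge_min.
  have [nN|Nn] := ltnP n N; first by rewrite (ltW (psiN (Ordinal nN))) orbT.
  apply/orP; left; rewrite -[leRHS]invrK lef_pV2 ?posrE ?invr_gt0//.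
  by apply: (le_trans (ltW (truncnS_gt _))); rewrite ler_nat; apply: leqW.
Qed.

End Metrization.

Lemma metrizable_Xhat : separable_space (alg A) -> metrizable R (Xhat A).
Proof.
move=> [D /pfcard_geP[D0|[v]] dD].
  have [x [_]] := dD setT (ex_intro _ 0 I) openT.
  by rewrite D0.
apply: (@metrizable_dense_sequence v) => O O0 oO.
have [f [Of Df]] := dD O O0 oO.
by have [n _ nf] := 'surj_v Df; exists f; split=> //; exists n.
Qed.


Lemma dhatfin_ge i phi psi f : finite_set i -> i f ->
  `|char_fun phi f - char_fun psi f| <= dhatfin (A := A) i phi psi.
Proof. by move=> fi; exact: (le_finite_sup (fun f => `|char_fun phi f - char_fun psi f|) fi). Qed.

Lemma dhatfin_le i phi psi c : 0 <= c ->
  (forall f, i f -> `|char_fun phi f - char_fun psi f| <= c) ->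
  dhatfin (A := A) i phi psi <= c.
Proof. exact: ge0_sup_le. Qed.

Lemma dhatfin_ge0 i phi psi : finite_set i -> 0 <= dhatfin (A := A) i phi psi.
Proof. by move=> fi; apply: finite_sup_ge0. Qed.

Lemma ext_semidistance_dhatfin i : finite_set i ->
  ext_semidistance (fun phi psi => (dhatfin (A := A) i phi psi)%:E).
Proof.
move=> fi; split.
- by move=> phi psi; rewrite lee_fin dhatfin_ge0.
- move=> phi; congr EFin; apply/eqP; rewrite eq_le dhatfin_ge0// andbT.
  by apply: dhatfin_le => // f _; rewrite subrr normr0.
- move=> phi psi; congr (EFin (sup (image _ _))); apply/funext => f.
  by rewrite distrC.
- move=> phi psi chi; rewrite -EFinD lee_fin; apply: dhatfin_le => [|f fif].
    by rewrite addr_ge0// dhatfin_ge0.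
  by apply: le_trans (ler_distD (char_fun psi f) _ _) _; apply: lerD; exact: dhatfin_ge.
Qed.

Lemma dhatfin_bounded i : finite_set i ->
  exists M : R, forall phi psi, dhatfin (A := A) i phi psi <= M.
Proof.
move=> fi; exists (sup [set 2 * (`|f| : R) | f in i]) => phi psi.
apply: dhatfin_le => [|f fif]; first by apply: finite_sup_ge0 => // f; rewrite mulr_ge0.
apply: le_trans (le_finite_sup (fun f : alg A => 2 * (`|f| : R)) fi fif).
rewrite mulrDl mul1r; apply: le_trans (ler_normB _ _) _.
by apply: lerD; exact: char_fun_le.
Qed.

Lemma dhatfin_continuous i : finite_set i ->
  continuous (fun z : Xhat A * Xhat A => dhatfin i z.1 z.2).
Proof.
move=> fi [phi psi]; apply/cvgrPdist_le => e e0 /=.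
have /finite_fsetP[D iD] := fi.
have near_f (f : alg A) : \forall z \near (phi, psi),
    `|(char_fun phi f - char_fun psi f) - (char_fun z.1 f - char_fun z.2 f)| <= e.
  have : char_fun z.1 f - char_fun z.2 f @[z --> (phi, psi)] -->
      char_fun phi f - char_fun psi f.
    apply: cvgB.
      apply: (@cvg_comp _ _ _ fst (gelfand f) (nbhs (phi, psi)) (nbhs phi)).
        exact: cvg_fst.
      exact: char_fun_continuous.
    apply: (@cvg_comp _ _ _ snd (gelfand f) (nbhs (phi, psi)) (nbhs psi)).
      exact: cvg_snd.
    exact: char_fun_continuous.
  by move=> /cvgrPdist_le; exact.
have : \forall z \near (phi, psi), forall f, i f ->
    `|(char_fun phi f - char_fun psi f) - (char_fun z.1 f - char_fun z.2 f)| <= e.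
  rewrite iD; exact: (@filter_bigI _ _ D _ _ _ (fun f _ => near_f f)).
apply: filterS => -[phi' psi'] /= close.
rewrite ler_distl; apply/andP; split.
  rewrite lerBlDr; apply: dhatfin_le => [|f fif].
    by rewrite addr_ge0 ?dhatfin_ge0// ltW.
  have -> : char_fun phi' f - char_fun psi' f = (char_fun phi f - char_fun psi f) -
    ((char_fun phi f - char_fun psi f) - (char_fun phi' f - char_fun psi' f)) by ring.
  apply: le_trans (ler_normB _ _) _; apply: lerD; [exact: dhatfin_ge|exact: close].
apply: dhatfin_le => [|f fif]; first by rewrite addr_ge0 ?dhatfin_ge0// ltW.
have -> : char_fun phi f - char_fun psi f = (char_fun phi' f - char_fun psi' f) +
  ((char_fun phi f - char_fun psi f) - (char_fun phi' f - char_fun psi' f)) by ring.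
apply: le_trans (ler_normD _ _) _; apply: lerD; [exact: dhatfin_ge|exact: close].
Qed.

Lemma dhatfin_iota i x y : dhatfin i (iotaX A x) (iotaX A y) = dfin i x y.
Proof. by []. Qed.

Lemma dhat_ge (f : alg A) phi psi : A1 A f ->
  (`|char_fun phi f - char_fun psi f|%:E <= dhat A phi psi)%E.
Proof. by move=> Af; apply: ereal_sup_ubound; exists f. Qed.

Hypothesis dX : ext_distance d.

Let d0 x y : (0 <= d x y)%E. Proof. by have [[]] := dX. Qed.

(** Everything that is shown for 1-Lipschitz functions extends by scaling to the
whole algebra. *)
Lemma A1_scale (f : alg A) : exists2 K : R, 0 < K & A1 A (K^-1 *: f).
Proof.
have [_ AL _] := alg_compatible A; have [_ /Lip_fin[K K0 fK]] := AL _ (alg_funP f).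
by exists K => //; exact: Lip_scale.
Qed.

Lemma A1_0 : A1 A 0.
Proof.
apply: Lip_le => // x y; rewrite mul1e !alg_fun0 subrr normr0; exact: d0.
Qed.

Lemma dhat_ge0 phi psi : (0 <= dhat A phi psi)%E.
Proof. by apply: le_trans (dhat_ge phi psi A1_0); rewrite lee_fin. Qed.

Lemma dhatE phi psi : dhat A phi psi =
  ereal_sup [set (dhatfin i phi psi)%:E | i in fin_A1 A].
Proof.
apply/eqP; rewrite eq_le; apply/andP; split.
  apply: ge_ereal_sup => _ [f Af <-].
  have fin1 : finite_set [set f] by exact: finite_set1.
  apply: (@le_trans _ _ (dhatfin [set f] phi psi)%:E).
    by rewrite lee_fin; exact: dhatfin_ge.
  by apply: ereal_sup_ubound; exists [set f] => //; split=> // _ ->.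
apply: ge_ereal_sup => _ [i [fi iA] <-].
have := dhat_ge0 phi psi; case e : (dhat A phi psi) => [r| |//] r0; last by rewrite leey.
rewrite lee_fin; apply: dhatfin_le => // f fif.
by rewrite -lee_fin -e; apply: dhat_ge; exact: iA.
Qed.

Lemma dhat_iota x y : dhat A (iotaX A x) (iotaX A y) = d x y.
Proof.
have [_ _ dE] := alg_compatible A; rewrite dE; congr ereal_sup.
apply/seteqP; split=> [_ [f Af <-]|_ [f [Af f1] <-]].
  by exists f => //; split=> //; exact: alg_funP.
by exists (to_alg Af).
Qed.

Lemma ext_distance_dhat : ext_distance (dhat A).
Proof.
split; [split|].
- exact: dhat_ge0.
- move=> phi; apply/eqP; rewrite eq_le dhat_ge0 andbT; apply: ge_ereal_sup => _ [f _ <-].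
  by rewrite subrr normr0.
- move=> phi psi; congr (ereal_sup (image _ _)); apply/funext => f.
  by rewrite distrC.
- move=> phi psi chi; apply: ge_ereal_sup => _ [f Af <-].
  apply: (@le_trans _ _ (`|char_fun phi f - char_fun psi f| + `|char_fun psi f - char_fun chi f|)%:E).
    by rewrite lee_fin ler_distD.
  by rewrite EFinD; apply: leeD; exact: dhat_ge.
move=> phi psi e; apply: char_fun_inj => f; have [K K0 /(dhat_ge phi psi)] := A1_scale f.
rewrite e lee_fin normr_le0 !char_funZ -mulrBr mulf_eq0 invr_eq0 (gt_eqF K0) /=.
by rewrite subr_eq0 => /eqP.
Qed.

Lemma Lip_gelfand_le1 (f : alg A) : A1 A f ->
  (Lip (gelfand f) [set: Xhat A] (dhat A) <= 1)%E.
Proof. by move=> Af; apply: Lip_le => // phi psi; rewrite mul1e; exact: dhat_ge. Qed.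

Lemma Gamma_image_Lipb : Gamma A @` A `<=` Lipb (dhat A).
Proof.
move=> g Gg; split; first exact: Gamma_image_Cb.
move: Gg => /GammaP[f ->]; have [K K0 fK] := A1_scale f.
apply: (@le_lt_trans _ _ K%:E); last by rewrite ltry.
apply: Lip_le => [|phi psi]; first by rewrite lee_fin ltW.
have := dhat_ge phi psi fK; rewrite !char_funZ -mulrBr normrM gtr0_norm ?invr_gt0//.
by rewrite EFinM lee_pdivrMl.
Qed.

(** Enlarging the family of competitors does not change dhat: a 1-Lipschitz function
for dhat has oscillation at most dhat by definition.  With B the image of the
algebra this is compatibility, and with B all the bounded Lipschitz functions it
is the last axiom of an extended metric-topological space. *)
Lemma dhat_sup_Lip1 (B : set (Xhat A -> R)) phi psi : Gamma A @` A `<=` B ->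
  dhat A phi psi = ereal_sup [set `|f phi - f psi|%:E |
    f in [set f | B f /\ (Lip f [set: Xhat A] (dhat A) <= 1)%E]].
Proof.
move=> GB; apply/eqP; rewrite eq_le; apply/andP; split.
  apply: ge_ereal_sup => _ [f Af <-]; apply: ereal_sup_ubound; exists (gelfand f) => //.
  by split; [apply/GB/GammaP; exists f|exact: Lip_gelfand_le1].
apply: ge_ereal_sup => _ [f [_ f1] <-].
by rewrite -[leRHS]mul1e; apply: le_Lip_dist => //; exact: dhat_ge0.
Qed.

Lemma compatible_Gamma : compatible_algebra (dhat A) (Gamma A @` A).
Proof.
split; [exact: Gamma_unital_subalgebra|exact: Gamma_image_Lipb|].
by move=> phi psi; exact: dhat_sup_Lip1.
Qed.

Lemma emt_space_Xhat : emt_space (dhat A).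
Proof.
split.
- exact: hausdorff_Xhat.
- exact: ext_distance_dhat.
- apply/generates_topologyP; split=> [f [[]]//|F phi FF Fphi].
  by apply/cvg_XhatP => f; apply: Fphi; apply/Gamma_image_Lipb/GammaP; exists f.
- by move=> phi psi; apply: dhat_sup_Lip1; exact: Gamma_image_Lipb.
Qed.

Lemma injective_iota : injective (iotaX A).
Proof.
have [_ dxy] := dX; move=> x y xy; apply: dxy.
by rewrite -dhat_iota xy; have [[_ ->]] := ext_distance_dhat.
Qed.

End GelfandCompactification.

(** * Radon measures and their images *)

Section RadonMeasures.
Context {R : realType} {X : ptopologicalType}.

Lemma open_borel (U : set X) : open U -> measurable (U : set (borel X)).
Proof. by move=> oU; exact: sub_sigma_algebra. Qed.

Lemma closed_borel (U : set X) : closed U -> measurable (U : set (borel X)).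
Proof.
move=> cU; rewrite -[U]setCK; apply: (@measurableC _ (borel X)).
by apply: open_borel; exact: closed_openC.
Qed.

Hypothesis hX : hausdorff_space X.

Lemma compact_borel (K : set X) : compact K -> measurable (K : set (borel X)).
Proof. by move=> cK; apply: closed_borel; exact: compact_closed. Qed.

Variable m : {finite_measure set (borel X) -> \bar R}.
Hypothesis rm : radon m.

Lemma radon_approx (B : set (borel X)) (e : R) : measurable B -> 0 < e ->
  exists K : set X, [/\ compact K, K `<=` B & (m (B `\` K) < e%:E)%E].
Proof.
move=> mB e0; have mBf : m B \is a fin_num by exact: fin_num_measure.
have : (m B - e%:E < m B)%E by rewrite lteBlDr// lteDl// lte_fin.
rewrite [X in (_ < X)%E](rm mB) => /ereal_sup_gt[_ [K [cK KB] <-] mK].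
exists K; split=> //; have mKm := compact_borel cK.
rewrite measureD// ?setIidr//; last by rewrite ltey_eq mBf.
have mKf : m K \is a fin_num by exact: fin_num_measure.
by move: mK; rewrite lteBlDr// lteBlDl// addeC.
Qed.

(** Compact sets K n whose complements have measure less than 1 / (n + 1). *)
Lemma radon_sigma_compact : exists K : nat -> set X,
  (forall n, compact (K n)) /\ m (~` \bigcup_n K n : set (borel X)) = 0%E.
Proof.
have h n : exists K : set X, [/\ compact K, K `<=` setT & (m (setT `\` K) < (n.+1%:R^-1)%:E)%E].
  by apply: (@radon_approx setT) => //; rewrite invr_gt0.
have [K hK] := choice h.
exists K; split=> [n|]; first by have [] := hK n.
have mU : measurable (\bigcup_n K n : set (borel X)).
  by apply: bigcup_measurable => n _; apply: compact_borel; have [] := hK n.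
apply/eqP; rewrite eq_le measure_ge0 andbT; apply/lee_addgt0Pr => e e0; rewrite add0e.
pose n := Num.truncn e^-1; have [cK _ mK] := hK n.
apply: (@le_trans _ _ (m (setT `\` K n : set (borel X)))).
  apply: le_measure; rewrite ?inE.
  - exact: measurableC.
  - by apply: measurableD => //; exact: compact_borel.
  - by rewrite setTD; apply: subsetC; exact: bigcup_sup.
apply/ltW/(lt_le_trans mK); rewrite lee_fin -[leRHS]invrK lef_pV2 ?posrE ?invr_gt0//.
by apply/ltW; exact: truncnS_gt.
Qed.

End RadonMeasures.

Section RadonImage.
Context {R : realType} {X Y : ptopologicalType}.
Variables (j : X -> Y) (cj : continuous j).
Hypotheses (hX : hausdorff_space X) (hY : hausdorff_space Y).

Lemma image_compact (K : set X) : compact K -> compact (j @` K).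
Proof. by apply: continuous_compact; exact: continuous_subspaceT. Qed.

Lemma borel_image_compact (K : set X) : compact K -> measurable (j @` K : set (borel Y)).
Proof. by move=> cK; apply: compact_borel => //; exact: image_compact. Qed.

Variable m : {finite_measure set (borel X) -> \bar R}.
Variable m' : {finite_measure set (borel Y) -> \bar R}.
Hypothesis jm : forall B : set (borel Y), measurable B ->
  pushforward m (j : borel X -> borel Y) B = m' B.
Hypothesis rm : radon m.

Let mj : measurable_fun [set: borel X] (j : borel X -> borel Y).
Proof. exact: continuous_measurable_borel. Qed.

Let mpre (B : set (borel Y)) : measurable B -> measurable (j @^-1` B : set (borel X)).
Proof. by move=> mB; rewrite -[X in measurable X]setTI; exact: mj. Qed.

(** A compact set in the preimage of B has a compact image, whose preimage contains
it; so compact approximation is transported from X to Y. *)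
Lemma radon_pushforward : radon m'.
Proof.
move=> B mB; apply/eqP; rewrite eq_le; apply/andP; split; last first.
  apply: ge_ereal_sup => _ [K [cK KB] <-].
  by apply: le_measure => //; rewrite inE//; exact: compact_borel.
rewrite -jm// [leLHS](rm (mpre mB)); apply: ge_ereal_sup => _ [K [cK KB] <-].
apply: (@le_trans _ _ (m' (j @` K))).
  rewrite -jm; last exact: borel_image_compact.
  apply: le_measure; rewrite ?inE; [exact: compact_borel| |exact: preimage_image].
  by apply: mpre; exact: borel_image_compact.
by apply: ereal_sup_ubound; exists (j @` K) => //; split; [exact: image_compact|exact/image_subP].
Qed.

Hypothesis ij : injective j.

(** For K compact, the sets E such that j (E cap K) is Borel form a sigma-algebra:
injectivity gives j (~ E cap K) = j K minus j (E cap K).  It contains the closed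
sets, whose traces on K have compact images. *)
Lemma borel_image_sigma_compact (K : nat -> set X) (E : set (borel X)) :
  (forall n, compact (K n)) -> measurable E ->
  measurable (j @` (E `&` \bigcup_n K n) : set (borel Y)).
Proof.
move=> cK mE; rewrite setI_bigcupr image_bigcup; apply: bigcup_measurable => n _.
move: (K n) (cK n) => {cK} {}K cK.
pose P : set (set X) := [set F | measurable (j @` (F `&` K) : set (borel Y))].
have PC F : P F -> P (~` F).
  rewrite /P /= => PF.
  rewrite (_ : j @` (~` F `&` K) = j @` K `\` j @` (F `&` K)).
    by apply: measurableD => //; exact: borel_image_compact.
  apply/seteqP; split=> [_ [x [Fx Kx] <-]|_ [[x Kx <-] Fx]].
    by split; [exists x|move=> [z [Fz _] /ij zx]; apply: Fx; rewrite -zx].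
  by exists x => //; split=> // Fx'; apply: Fx; exists x.
suff : <<s @open X >> `<=` P by exact.
apply: smallest_sub; first split.
- by rewrite /P /= set0I image_set0; exact: measurable0.
- by move=> F PF; rewrite setTD; exact: PC.
- move=> F PF; rewrite /P /= setI_bigcupl image_bigcup.
  by apply: bigcup_measurable => k _; exact: PF.
move=> U oU; rewrite -[U]setCK; apply: PC; apply: borel_image_compact.
by rewrite setIC; apply: compact_closedI => //; exact: open_closedC.
Qed.

End RadonImage.

(** * Pull-back of L^p classes *)

Section LspaceClasses.
Context d0 {T : measurableType d0} {R : realType} (mu : {measure set T -> \bar R}).
Context (p : R) (p1 : (1 <= p%:E)%E).

Let p0 : 0 < p.
Proof. by move: p1; rewrite lee_fin; exact: lt_le_trans. Qed.

Lemma measurable_powR_norm (f : T -> R) : measurable_fun setT f ->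
  measurable_fun setT (fun x => (`|f x| `^ p)%:E).
Proof.
move=> mf; apply/measurable_EFinP/(@measurableT_comp _ _ _ _ _ _ (fun x : R => x `^ p)) => //.
exact: measurableT_comp.
Qed.

Lemma LfunP_integral (f : T -> R) : measurable_fun setT f ->
  f \in Lfun mu p%:E <-> (\int[mu]_x (`|f x| `^ p)%:E < +oo)%E.
Proof.
move=> mf; have I0 : (0 <= \int[mu]_x (`|f x| `^ p)%:E)%E.
  by apply: integral_ge0 => x _; rewrite lee_fin powR_ge0.
split=> [/sub_Lfun_finLfun/set_mem fy|fy].
  by rewrite -(@powR_Lnorm _ _ _ mu (EFin \o f) p (lt0r_neq0 p0)); exact: poweR_lty.
apply/andP; split; rewrite inE //= /finite_norm.
by rewrite unlock /Lnorm /=; exact: poweR_lty.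
Qed.

Lemma Lclass_norm_lt (f : LfunType mu p1) e : 0 < e ->
  (\int[mu]_x (`|f x| `^ p)%:E < (e `^ p)%:E)%E -> `|Lclass f| < e.
Proof.
move=> e0; apply: contraTT; rewrite -!leNgt => ef.
have := powR_Lnorm mu (EFin \o f) (lt0r_neq0 p0).
rewrite -(finite_norm_fine f) /= => <-; rewrite lee_fin.
rewrite -(Lclass_norm f); apply: ge0_ler_powR => //; rewrite ?nnegrE ?(ltW p0) ?(ltW e0)//.
exact: le_trans (ltW e0) ef.
Qed.

Lemma Lclass_sub (f g : LfunType mu p1) :
  Lclass (f - g) = Lclass f - Lclass g :> LspaceType mu p1.
Proof. by rewrite Lclass_add Lclass_opp. Qed.

Lemma Lclass_linear (a : R) (f g : LfunType mu p1) :
  Lclass (a *: f + g) = a *: Lclass f + Lclass g :> LspaceType mu p1.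
Proof. by rewrite Lclass_add Lclass_scale. Qed.

End LspaceClasses.

Section PullbackIsometry.
Context d d' {T : measurableType d} {T' : measurableType d'} {R : realType}.
Variables (m : {measure set T -> \bar R}) (m' : {measure set T' -> \bar R}).
Variables (j : T -> T') (mj : measurable_fun [set: T] j).
Hypothesis jm : forall B, measurable B -> pushforward m j B = m' B.
Variables (p : R) (p1 : (1 <= p%:E)%E).

Lemma ae_pullback (P : T' -> Prop) : {ae m', forall y, P y} -> {ae m, forall x, P (j x)}.
Proof.
move=> [N [mN N0 PN]]; exists (j @^-1` N); split.
- by rewrite -[X in measurable X]setTI; exact: mj.
- by rewrite -[LHS]/(pushforward m j N) jm.
- by move=> x /= Px; exact: PN.
Qed.

Lemma Lnorm_pullback (f : T' -> R) : measurable_fun setT f ->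
  ('N[m]_p%:E[EFin \o (f \o j)] = 'N[m']_p%:E[EFin \o f])%E.
Proof.
move=> mf.
have mfp := measurable_powR_norm p mf.
rewrite unlock /Lnorm /=; congr (_ `^ _)%E.
have f0 : {in [set: T'], forall y, (0 <= (`|f y| `^ p)%:E)%E}.
  by move=> y _; rewrite lee_fin powR_ge0.
rewrite -[LHS](ge0_integral_pushforward mj m measurableT mfp f0).
by apply: eq_measure_integral => B mB _; rewrite -(jm mB).
Qed.

Lemma Lp_pullback_class (f : LfunType m' p1) (g : LfunType m p1) :
  (f : T' -> R) \o j = g -> Lp_pullback mj jm p1 (Lclass f) = Lclass g.
Proof.
move=> fg; apply/eq_Lclass.
have := ae_pullback (LclassK f); apply: filterS => x /= h _.
by rewrite -fg; exact: h.
Qed.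

Lemma Lp_pullback_linear : linear (Lp_pullback mj jm p1).
Proof.
move=> a u v; rewrite -[u]LreprK -[v]LreprK; set f := Lrepr u; set g := Lrepr v.
rewrite -Lclass_linear.
pose jf := Lfun_Sub p1 (Lfun_pullback mj jm f).
pose jg := Lfun_Sub p1 (Lfun_pullback mj jm g).
rewrite (@Lp_pullback_class (a *: f + g) (a *: jf + jg))//.
by rewrite Lclass_linear (@Lp_pullback_class f jf)// (@Lp_pullback_class g jg).
Qed.

Lemma Lp_pullback_norm (u : LspaceType m' p1) : `|Lp_pullback mj jm p1 u| = `|u|.
Proof.
rewrite -[u]LreprK; set f := Lrepr u.
rewrite (@Lp_pullback_class f (Lfun_Sub p1 (Lfun_pullback mj jm f)))//.
rewrite [LHS]Lclass_norm [RHS]Lclass_norm; congr fine.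
by apply: Lnorm_pullback; exact: measurable_funPT.
Qed.

End PullbackIsometry.

Section PullbackSurjective.
Context {R : realType} {X Y : ptopologicalType}.
Variables (j : X -> Y) (cj : continuous j) (ij : injective j).
Hypotheses (hX : hausdorff_space X) (hY : hausdorff_space Y).
Variable m : {finite_measure set (borel X) -> \bar R}.
Variable m' : {finite_measure set (borel Y) -> \bar R}.
Hypothesis jm : forall B : set (borel Y), measurable B ->
  pushforward m (j : borel X -> borel Y) B = m' B.
Hypothesis rm : radon m.
Variable mj : measurable_fun [set: borel X] (j : borel X -> borel Y).

(** The function f o j^-1 on the image of a sigma-compact set of full measure,
extended by 0; its measurability is the Borel character of the images j (E cap C). *)
Lemma measurable_extension (f : X -> R) :
  measurable_fun [set: borel X] (f : borel X -> R) ->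
  exists g : Y -> R, measurable_fun [set: borel Y] (g : borel Y -> R) /\
    {ae m, forall x : borel X, g (j x) = f x}.
Proof.
move=> mf; have [K [cK K0]] := radon_sigma_compact hX rm.
pose C := \bigcup_n K n; pose S := j @` C.
have mC : measurable (C : set (borel X)).
  by apply: bigcup_measurable => n _; exact: compact_borel.
have mS : measurable (S : set (borel Y)).
  by rewrite /S -[C]setTI; apply: borel_image_sigma_compact.
pose g y := if y \in S then f (xget point [set x | C x /\ j x = y]) else 0.
have gj x : C x -> g (j x) = f x.
  move=> Cx; rewrite /g mem_set; last by exists x.
  have [_ /ij ->//] : [set z | C z /\ j z = j x] (xget point [set z | C z /\ j z = j x]).
  by apply: xgetPex; exists x.
exists g; split; last first.
  exists (~` C); split; [exact: measurableC|exact: K0|].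
  by move=> x /= gx Cx; apply: gx; exact: gj.
rewrite -(setUv S); apply/measurable_funU => //; first exact: measurableC.
split.
- move=> _ B mB; rewrite (_ : _ `&` _ = j @` (f @^-1` B `&` C)).
    apply: borel_image_sigma_compact => //.
    by rewrite -[X in measurable X]setTI; exact: mf.
  apply/seteqP; split=> [_ [[x Cx <-] /=]|_ [x [Bfx Cx] <-]].
    by rewrite gj// => Bfx; exists x.
  by split; [exists x|rewrite /= gj].
- apply: (@eq_measurable_fun _ _ (borel Y) (measurableTypeR R) (~` S) (cst 0)) => // y.
  by rewrite inE /= => nSy; rewrite /g memNset.
Qed.

Variables (p : R) (p1 : (1 <= p%:E)%E).

Lemma Lp_pullback_surj (u : LspaceType m p1) :
  exists v : LspaceType m' p1, Lp_pullback mj jm p1 v = u.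
Proof.
rewrite -[u]LreprK; set f := Lrepr u.
have [g [mg gf]] := measurable_extension (@measurable_funPT _ _ _ _ f).
have Lg : (g : borel Y -> R) \in Lfun m' p%:E.
  apply/andP; split; rewrite inE //= /finite_norm.
  rewrite -(Lnorm_pullback mj jm)//.
  rewrite (@eq_ae_Lnorm _ _ _ _ _ _ f)//.
  - exact: Lfunction_finite.
  - exact: measurableT_comp.
  - by apply: filterS gf => x gx _.
exists (Lclass (Lfun_Sub p1 Lg)).
rewrite (@Lp_pullback_class _ _ _ _ _ _ _ _ mj jm _ p1 _
  (Lfun_Sub p1 (Lfun_pullback mj jm (Lfun_Sub p1 Lg))))//.
by apply/eq_Lclass; apply: filterS gf => x gx _.
Qed.

End PullbackSurjective.

(** * Density of continuous functions in L^p *)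

Lemma compact_Cb (R : realType) (Y : topologicalType) (f : Y -> R) :
  compact [set: Y] -> continuous f -> Cb f.
Proof.
move=> cY cf; split=> //.
have : compact (f @` [set: Y]) by apply: continuous_compact => //; exact: continuous_subspaceT.
move=> /compact_bounded[M [Mr fM]]; exists M; split=> // N MN x _ /=.
by apply: fM MN _ _; exists x.
Qed.

Import HBNNSimple.

Section DensityOfContinuous.
Context {R : realType} {Y : ptopologicalType}.
Hypotheses (hY : hausdorff_space Y) (cY : compact [set: Y]).
Variable m : {finite_measure set (borel Y) -> \bar R}.
Hypothesis rm : radon m.
Variables (p : R) (p1 : (1 <= p%:E)%E).

Let p0 : 0 < p.
Proof. by move: p1; rewrite lee_fin; exact: lt_le_trans. Qed.

Lemma Lcb_linear a (f g h : Y -> R) (Cf : Cb f) (Cg : Cb g) (Ch : Cb h) :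
  (forall y, h y = a * f y + g y) ->
  Lcb m p1 Ch = a *: Lcb m p1 Cf + Lcb m p1 Cg.
Proof.
move=> hE; rewrite /Lcb -Lclass_linear; congr Lclass.
by apply/LfuneqP => y; exact: hE.
Qed.

Let Cb_limit (u : LspaceType m p1) := forall e : R, 0 < e ->
  exists f (Cf : @Cb R Y f), `|u - Lcb m p1 Cf| < e.

Let Cb_limit_linear a u v : Cb_limit u -> Cb_limit v -> Cb_limit (a *: u + v).
Proof.
move=> Wu Wv e e0; have a1 : 0 < `|a| + 1 by have := normr_ge0 a; lra.
have e20 : 0 < e / 2 by lra.
have [f [Cf uf]] := Wu _ (divr_gt0 e20 a1); have [g [Cg vg]] := Wv _ e20.
have Ch : Cb (fun y => a * f y + g y).
  apply: compact_Cb => // y; apply: cvgD; last exact: Cg.1.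
  by apply: cvgM; [exact: cvg_cst|exact: Cf.1].
exists _, Ch; rewrite (Lcb_linear Cf Cg Ch (fun=> erefl)).
rewrite opprD addrACA -scalerBr; apply: le_lt_trans (ler_normD _ _) _.
rewrite normrZ [ltRHS](splitr e); apply: ler_ltD => //.
apply: (@le_trans _ _ ((`|a| + 1) * (e / 2 / (`|a| + 1)))).
  by apply: ler_pM => //; [rewrite lerDl|exact: ltW].
by rewrite mulrC divfK// gt_eqF.
Qed.

Let Cb_limit_lim u : (forall e, 0 < e -> exists2 v, Cb_limit v & `|u - v| < e) -> Cb_limit u.
Proof.
move=> Wu e e0; have e20 : 0 < e / 2 by lra.
have [v Wv uv] := Wu _ e20; have [f [Cf vf]] := Wv _ e20.
exists f, Cf; rewrite -(subrKA v) [ltRHS](splitr e).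
by apply: le_lt_trans (ler_normD _ _) _; exact: ltrD.
Qed.

Let Cb_limit_fun (f : borel Y -> R) := exists hf : f \in Lfun m p%:E, Cb_limit (Lclass (Lfun_Sub p1 hf)).

Let Cb_limit_fun_linear a f g : Cb_limit_fun f -> Cb_limit_fun g -> Cb_limit_fun (fun y => a * f y + g y).
Proof.
move=> [hf Wh] [hg Wg].
have hh : (fun y => a * f y + g y) \in Lfun m p%:E.
  exact: (LfunP (a *: Lfun_Sub p1 hf + Lfun_Sub p1 hg)).
exists hh; rewrite (_ : Lfun_Sub p1 hh = a *: Lfun_Sub p1 hf + Lfun_Sub p1 hg).
  by rewrite Lclass_linear; exact: Cb_limit_linear.
exact/LfuneqP.
Qed.

Let Cb_limit_fun_0 : Cb_limit_fun (fun=> 0).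
Proof.
have C0 : @Cb R Y (fun=> 0) by apply: compact_Cb => // y; exact: cvg_cst.
exists (Cb_Lfun m p1 C0) => e e0; exists (fun=> 0), C0.
by rewrite /Lcb subrr normr0.
Qed.

Let bounded_Lfun (f : borel Y -> R) : measurable_fun setT f ->
  (forall y, `|f y| <= 1) -> f \in Lfun m p%:E.
Proof.
move=> mf f1; apply/LfunP_integral => //.
apply: (@le_lt_trans _ _ (\int[m]_x (cst 1%E x))%E); last first.
  by rewrite integral_cst// mul1e ltey_eq fin_num_measure.
apply: ge0_le_integral => //.
- exact: measurable_powR_norm.
- move=> x _; rewrite lee_fin; apply: (@le_trans _ _ (1 `^ p)); last by rewrite powR1.
  by apply: ge0_ler_powR => //; rewrite ?nnegrE// ltW.
Qed.

(** Compact sets K inside B and L inside its complement exhaust the space up to a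
set of small measure; a Urysohn function that is 1 on K and 0 on L differs from
the indicator only there, and by at most 1. *)
Let Cb_limit_fun_indic (B : set (borel Y)) : measurable B -> Cb_limit_fun \1_B.
Proof.
move=> mB.
have hB : (\1_B : borel Y -> R) \in Lfun m p%:E.
  apply: bounded_Lfun => // y; rewrite indicE.
  by case: (_ \in _); rewrite ?normr1 ?normr0.
exists hB => e e0; pose c := e `^ p / 2.
have ep0 : 0 < e `^ p by exact: powR_gt0.
have c0 : 0 < c by rewrite /c; lra.
have [K [cK KB mK]] := radon_approx hY rm mB c0.
have [L [cL LB mL]] := radon_approx hY rm (measurableC mB) c0.
have mK' : measurable (K : set (borel Y)) by exact: compact_borel.
have mL' : measurable (L : set (borel Y)) by exact: compact_borel.
have LK : L `&` K = set0.
  by rewrite -subset0 => y [/LB nBy /KB]; exact: nBy.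
have := (@normal_separatorP R Y).1 (compact_normal hY cY).
move=> /(_ L K (compact_closed hY cL) (compact_closed hY cK) LK).
move=> /(@uniform_separatorP Y R)[h [ch h01 hL hK]].
have Ch : Cb h by exact: compact_Cb.
exists h, Ch; rewrite /Lcb -Lclass_sub; apply: Lclass_norm_lt => //.
pose D := (B `\` K) `|` (~` B `\` L).
have mD : measurable D by apply: measurableU; apply: measurableD => //; exact: measurableC.
apply: (@le_lt_trans _ _ (\int[m]_x (\1_D x)%:E)%E); last first.
  rewrite integral_indic// setIT; apply: le_lt_trans (measureU2 _ _ _) _.
  - exact: measurableD.
  - by apply: measurableD => //; exact: measurableC.
  by rewrite (splitr (e `^ p)) EFinD; exact: lteD.
apply: ge0_le_integral => //.
- apply: measurable_powR_norm; exact: measurable_funPT.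
- by apply/measurable_EFinP.
- move=> y _; rewrite lee_fin.
  have hy : 0 <= h y <= 1 by have := h01 (h y); rewrite /= in_itv /=; apply; exists y.
  have -> : (Lfun_Sub p1 hB - Lfun_Sub p1 (Cb_Lfun m p1 Ch)) y = \1_B y - h y by [].
  have hK1 : K y -> h y = 1 by move=> Ky; apply: hK; exists y.
  have hL0 : L y -> h y = 0 by move=> Ly; apply: hL; exists y.
  have [yD|nyD] := pselect (D y).
    rewrite !indicE (mem_set yD); apply: (@le_trans _ _ (1 `^ p)); last by rewrite powR1.
    apply: ge0_ler_powR => //; rewrite ?nnegrE ?(ltW p0)//.
    by rewrite ler_norml; case: (_ \in _); rewrite ?mulr1n ?mulr0n; lra.
  suff -> : \1_B y - h y = 0 by rewrite normr0 powR0 ?(lt0r_neq0 p0).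
  rewrite indicE; have [By|nBy] := pselect (B y).
    rewrite mem_set// hK1 ?subrr//.
    by apply: contrapT => nKy; apply: nyD; left.
  rewrite memNset// hL0 ?subrr//.
  by apply: contrapT => nLy; apply: nyD; right.
Qed.

Let Cb_limit_fun_nnsfun (s : {nnsfun borel Y >-> R}) : Cb_limit_fun (s : Y -> R).
Proof.
have Wsum n (v : nat -> R) :
    Cb_limit_fun (fun y => \sum_(i < n) (v i * \1_(s @^-1` [set v i]) y)).
  elim: n => [|n ih].
    rewrite (_ : (fun y => _) = fun=> 0); first exact: Cb_limit_fun_0.
    by apply/funext => y; rewrite big_ord0.
  rewrite (_ : (fun y => _) = fun y => v n * \1_(s @^-1` [set v n]) y +
      \sum_(i < n) (v i * \1_(s @^-1` [set v i]) y)).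
    by apply: Cb_limit_fun_linear => //; apply: Cb_limit_fun_indic.
  by apply/funext => y; rewrite big_ord_recr /= addrC.
have := Wsum #|` fset_set (range s)| (fun i => (fset_set (range s))`_i).
by congr Cb_limit_fun; apply/funext => y; rewrite -fimfunEord.
Qed.

(** The simple functions s_n increase to f, and |f - s_n|^p is dominated by |f|^p. *)
Let Cb_limit_fun_ge0 (f : borel Y -> R) : f \in Lfun m p%:E -> (forall y, 0 <= f y) -> Cb_limit_fun f.
Proof.
move=> hf f0; exists hf; apply: Cb_limit_lim => e e0.
have mf : measurable_fun setT f by exact: (@measurable_funPT _ _ _ _ (Lfun_Sub p1 hf)).
have mEf : measurable_fun setT (EFin \o f) by exact/measurable_EFinP.
pose s := nnsfun_approx measurableT mEf.
have sf n y : s n y <= f y.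
  by rewrite -lee_fin nnsfun_approxE; apply: le_approx => // z _; rewrite lee_fin.
have scvg y : s n y @[n --> \oo] --> f y.
  have := @cvg_nnsfun_approx _ _ _ _ measurableT _ mEf (fun z _ => f0 z) y I.
  by move=> /fine_cvgP[].
have : (\int[m]_y (`|f y - s n y| `^ p)%:E)%E @[n --> \oo] --> 0%E.
  have mI n : measurable_fun setT (fun y : borel Y => (`|f y - s n y| `^ p)%:E).
    apply: (measurable_powR_norm p (f := fun y => f y - s n y)).
    by apply: measurable_funB => //; exact: measurable_funPT.
  have I0 : {ae m, forall y, [set: borel Y] y ->
      (`|f y - s n y| `^ p)%:E @[n --> \oo] --> cst 0%E y}.
    apply: aeW => y _; apply: cvg_EFin; first exact: nearW.
    apply/cvgrPdist_lt => c c0.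
    have cp0 : 0 < c `^ p^-1 by exact: powR_gt0.
    have /cvgrPdist_lt /(_ _ cp0) := scvg y; apply: filterS => n fs.
    rewrite /= sub0r normrN ger0_norm ?powR_ge0//.
    apply: (@lt_le_trans _ _ ((c `^ p^-1) `^ p)).
      by apply: gt0_ltr_powR => //; rewrite nnegrE// ltW.
    by rewrite -powRrM mulVf ?(lt0r_neq0 p0)// powRr1// ltW.
  have intf : m.-integrable setT (fun y : borel Y => (`|f y| `^ p)%:E).
    apply/integrableP; split; first exact: measurable_powR_norm.
    apply: le_lt_trans ((LfunP_integral m p1 mf).1 hf).
    apply: ge0_le_integral => //.
    + by apply: measurableT_comp => //; exact: measurable_powR_norm.
    + exact: measurable_powR_norm.
    + by move=> y _; rewrite gee0_abs// lee_fin powR_ge0.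
  have dom : {ae m, forall y n, [set: borel Y] y ->
      (`| (`|f y - s n y| `^ p)%:E | <= (`|f y| `^ p)%:E)%E}.
    apply: aeW => y n _; rewrite gee0_abs ?lee_fin ?powR_ge0//.
    apply: ge0_ler_powR => //; rewrite ?nnegrE ?(ltW p0)//.
    rewrite !ger0_norm ?f0 ?subr_ge0//.
    by rewrite lerBlDr lerDl.
  have [_ _] := dominated_convergence measurableT mI (measurable_cst _) I0 intf dom.
  by rewrite integral0.
have ep0 : (0 < (e `^ p)%:E)%E by rewrite lte_fin powR_gt0.
move=> /(_ _ (open_nbhs_nbhs (conj (@open_ereal_lt_ereal _ (e `^ p)%:E) ep0))).
move=> /(@filter_ex _ _ eventually_filter)[n /= sn].
have [hs Ws] := Cb_limit_fun_nnsfun (s n).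
exists (Lclass (Lfun_Sub p1 hs)) => //.
by rewrite -Lclass_sub; apply: Lclass_norm_lt.
Qed.

Theorem Cb_dense_Lspace (u : LspaceType m p1) (e : R) : 0 < e ->
  exists f (Cf : @Cb R Y f), `|u - Lcb m p1 Cf| < e.
Proof.
move: e; suff : Cb_limit u by [].
rewrite -[u]LreprK; set f := Lrepr u.
have mf : measurable_fun setT (f : borel Y -> R) by exact: (@measurable_funPT _ _ _ _ f).
have If : (\int[m]_y (`|f y| `^ p)%:E < +oo)%E by apply/LfunP_integral => //; exact: LfunP.
have Wpart (g : borel Y -> R) : measurable_fun setT g ->
    (forall y, 0 <= g y) -> (forall y, `|g y| <= `|f y|) -> Cb_limit_fun g.
  move=> mg g0 gf; apply: Cb_limit_fun_ge0 => //; apply/LfunP_integral => //.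
  apply: le_lt_trans If; apply: ge0_le_integral => //.
  - exact: measurable_powR_norm.
  - exact: measurable_powR_norm.
  - move=> y _; rewrite lee_fin; apply: ge0_ler_powR => //.
    by rewrite ltW.
have Wpos : Cb_limit_fun (fun y => 2^-1 * (`|f y| + f y)).
  apply: Wpart => [|y|y].
  - by apply: measurable_funM => //; apply: measurable_funD => //; exact: measurableT_comp.
  - by have := ler_norm (- f y); rewrite normrN; lra.
  - have := ler_norm (- f y); have := ler_norm (f y); rewrite normrN => h1 h2.
    by rewrite ger0_norm; lra.
have Wneg : Cb_limit_fun (fun y => 2^-1 * (`|f y| - f y)).
  apply: Wpart => [|y|y].
  - by apply: measurable_funM => //; apply: measurable_funB => //; exact: measurableT_comp.
  - by have := ler_norm (f y); lra.
  - have := ler_norm (- f y); have := ler_norm (f y); rewrite normrN => h1 h2.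
    by rewrite ger0_norm; lra.
have [h Wh] := Cb_limit_fun_linear (-1) Wneg Wpos.
suff -> : f = Lfun_Sub p1 h by [].
by apply/LfuneqP => y; rewrite /=; field.
Qed.

End DensityOfContinuous.

(** A uniform bound c on |f - g| gives the bound c m(Y)^(1/p) in L^p; the constant
below is chosen with c^p = e^p / (m(Y) + 1). *)
Lemma Lcb_uniform (R : realType) (Y : ptopologicalType)
    (m : {finite_measure set (borel Y) -> \bar R}) (p : R) (p1 : (1 <= p%:E)%E) (e : R) :
  0 < e -> exists2 c : R, 0 < c & forall f g (Cf : @Cb R Y f) (Cg : @Cb R Y g),
    (forall y, `|f y - g y| <= c) -> `|Lcb m p1 Cf - Lcb m p1 Cg| < e.
Proof.
move=> e0; have p0 : 0 < p by move: p1; rewrite lee_fin; exact: lt_le_trans.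
pose M := fine (m [set: borel Y]).
have M0 : 0 <= M by rewrite fine_ge0.
have ME : m [set: borel Y] = M%:E by rewrite fineK// fin_num_measure.
have ep0 : 0 < e `^ p by exact: powR_gt0.
have c0 : 0 < e `^ p / (M + 1) by rewrite divr_gt0//; lra.
exists ((e `^ p / (M + 1)) `^ p^-1); first exact: powR_gt0.
move=> f g Cf Cg fg; rewrite /Lcb -Lclass_sub; apply: Lclass_norm_lt => //.
apply: (@le_lt_trans _ _ (\int[m]_x (cst (e `^ p / (M + 1))%:E x))%E); last first.
  rewrite integral_cst// [X in (_ * X)%E](ME) -EFinM lte_fin mulrAC ltr_pdivrMr; last by lra.
  by rewrite ltr_pM2l//; lra.
apply: ge0_le_integral => //.
- by apply: measurable_powR_norm; exact: measurable_funPT.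
- move=> y _; rewrite lee_fin; apply: (@le_trans _ _ (((e `^ p / (M + 1)) `^ p^-1) `^ p)).
    by apply: ge0_ler_powR => //; rewrite ?nnegrE ?powR_ge0 ?(ltW p0)//; exact: fg.
  by rewrite -powRrM mulVf ?(lt0r_neq0 p0)// powRr1// ltW.
Qed.

(** * The measure and the L^p spaces of the compactification *)

Section GelfandLspace.
Context {R : realType} {X : ptopologicalType} {d : X -> X -> \bar R}.
Variables (m : {finite_measure set (borel X) -> \bar R}) (A : compat_algebra d).
Hypotheses (hX : hausdorff_space X) (dX : ext_distance d) (rm : radon m).

Lemma radon_mhat : radon (mhat A m).
Proof.
apply: (radon_pushforward (j := iotaX A) _ hX _ (m := m)) => //.
- exact: iota_continuous.
- exact: hausdorff_Xhat.
Qed.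

Lemma mhat_range_iota : exists S : set (borel (Xhat A)),
  [/\ measurable S, S `<=` range (iotaX A) & mhat A m (~` S) = 0%E].
Proof.
have [K [cK K0]] := radon_sigma_compact hX rm.
exists (\bigcup_n (iotaX A @` K n)); split.
- apply: bigcup_measurable => n _; apply: borel_image_compact => //.
    exact: iota_continuous.
  exact: hausdorff_Xhat.
- by move=> _ [n _ [x _ <-]]; exists x.
- rewrite -K0; congr (m _); apply/seteqP; split=> x nx [n _ Kx]; apply: nx.
    by exists n => //; exists x.
  by case: Kx => z Kz /(injective_iota dX) <-; exists n.
Qed.

Lemma negligible_range_iota : (mhat A m).-negligible (~` range (iotaX A)).
Proof.
have [S [mS SX S0]] := mhat_range_iota.
by exists (~` S); split=> [||x nx /SX//]; first exact: measurableC.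
Qed.

Lemma completed_range_iota : completed_algebra_gen (mhat A m) (range (iotaX A)).
Proof.
have [S [mS SX S0]] := mhat_range_iota.
exists S => //; exists (range (iotaX A) `\` S); last exact: setDUK.
by exists (~` S); split=> [||y []//]; first exact: measurableC.
Qed.

Variables (p : R) (p1 : (1 <= p%:E)%E).

Let j := @iota_pullback R X d A m p p1.

Let j_linear : linear j. Proof. exact: Lp_pullback_linear. Qed.

Let j_norm u : `|j u| = `|u|. Proof. exact: Lp_pullback_norm. Qed.

Let j_inj : injective j.
Proof.
move=> u v uv; apply/eqP; rewrite -subr_eq0 -normr_eq0 -j_norm.
have -> : u - v = -1 *: v + u by rewrite scaleN1r addrC.
by rewrite j_linear uv scaleN1r addNr normr0.
Qed.

Let j_surj u : exists v, j v = u.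
Proof.
apply: Lp_pullback_surj => //.
- exact: iota_continuous.
- exact: injective_iota.
- exact: hausdorff_Xhat.
Qed.

Let j_Lcb (f : alg A) : j (Lcb (mhat A m) p1 (Gamma_Cb f)) = Lcb m p1 (alg_Cb f).
Proof.
apply: Lp_pullback_class; apply/funext => x; exact: (GammaE f).
Qed.

Lemma Gamma_dense_Lspace (u : LspaceType (mhat A m) p1) (e : R) : 0 < e ->
  exists f : alg A, `|u - Lcb (mhat A m) p1 (Gamma_Cb f)| < e.
Proof.
move=> e0.
have e20 : 0 < e / 2 by lra.
have [f [Cf uf]] := Cb_dense_Lspace (@hausdorff_Xhat _ _ _ A) (@compact_Xhat _ _ _ A)
  radon_mhat u e20.
have [c c0 fc] := Lcb_uniform (mhat A m) p1 e20.
have [_ /GammaP[g ->] fg] := Gamma_uniformly_dense Cf.1 c0.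
exists g; rewrite -(subrKA (Lcb (mhat A m) p1 Cf)) [ltRHS](splitr e).
apply: le_lt_trans (ler_normD _ _) _; apply: ltrD => //; apply: fc => phi.
by rewrite GammaE; exact: fg.
Qed.

(** iota_star is the inverse of the pull-back.  Two isometric extensions agree on
the classes of the algebra, which are dense in L^p(X) because the pull-back is
an isometry onto L^p(X) and sends the dense classes of the image of the Gelfand
transform onto them. *)
Theorem iota_star_ex :
     exists iota_star : {linear LspaceType m p1 -> LspaceType (mhat A m) p1},
       [/\ cancel (iota_pullback A m p1) iota_star,
           cancel iota_star (iota_pullback A m p1),
           (forall u, `|iota_star u| = `|u|),
           (forall f : alg A,
              iota_star (Lcb m p1 (alg_Cb f)) = Lcb (mhat A m) p1 (Gamma_Cb f)) &
           forall S : {linear LspaceType m p1 -> LspaceType (mhat A m) p1},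
             (forall u, `|S u| = `|u|) ->
             (forall f : alg A,
                S (Lcb m p1 (alg_Cb f)) = Lcb (mhat A m) p1 (Gamma_Cb f)) ->
             S =1 iota_star].
Proof.
have [s js] := choice j_surj.
have sj : cancel j s by move=> u; apply: j_inj; rewrite js.
have s_linear : linear s.
  by move=> a u v; apply: j_inj; rewrite j_linear !js.
have s_norm u : `|s u| = `|u| by rewrite -j_norm js.
have s_Lcb f : s (Lcb m p1 (alg_Cb f)) = Lcb (mhat A m) p1 (Gamma_Cb f).
  by rewrite -j_Lcb sj.
pose S0 : {linear LspaceType m p1 -> LspaceType (mhat A m) p1} :=
  HB.pack s (GRing.isLinear.Build R (LspaceType m p1) (LspaceType (mhat A m) p1) *:%R s s_linear).
have sB u v : s (u - v) = s u - s v by exact: (linearB S0).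
exists S0; split=> //.
move=> S S_norm S_Lcb u; apply/eqP; rewrite -subr_eq0 -normr_le0.
apply/ler_addgt0Pr => e e0; rewrite add0r.
have [f uf] := Gamma_dense_Lspace (s u) (divr_gt0 e0 (ltr0n _ 2)).
set w := Lcb m p1 (alg_Cb f).
have wu : `|u - w| < e / 2.
  by rewrite -s_norm sB /w s_Lcb.
have -> : S u - s u = S (u - w) - s (u - w).
  by rewrite linearB sB S_Lcb s_Lcb opprB addrA subrK.
apply: le_trans (ler_normB _ _) _; rewrite S_norm s_norm [leRHS](splitr e).
by apply: lerD; exact: ltW.
Qed.

End GelfandLspace.

Theorem theorem2p34 (R : realType) (X : ptopologicalType)
    (d : X -> X -> \bar R) (m : {finite_measure set (borel X) -> \bar R})
    (A : compat_algebra d) (HX : emtm_space d m) :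
  (* (a) *)
  ([/\ continuous (iotaX A),
       injective (iotaX A),
       dense (range (iotaX A)),
       compact [set: Xhat A] &
       hausdorff_space (Xhat A)] /\
   (separable_space (alg A) -> metrizable R (Xhat A))) /\
  (* (b) *)
  (homeo_onto_image (iotaX A) <-> adapted_algebra d A) /\
  (* (c) *)
  [/\ (forall f, uclosure A f ->
         [/\ Cb (Gamma A f),
             Gamma A f \o iotaX A = f &
             forall g : Xhat A -> R,
               continuous g -> g \o iotaX A = f -> g = Gamma A f]),
      unital_subalgebra (Gamma A @` A),
      Gamma A @` A `<=` Cb (X := Xhat A),
      Cb (X := Xhat A) `<=`
        closure (Gamma A @` A : set {uniform Xhat A -> R}) &
      [set g \o iotaX A | g in Gamma A @` A] = A] /\
  (* (d) *)
  [/\ radon (mhat A m),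
      completed_algebra_gen (mhat A m) (range (iotaX A)) &
      (mhat A m).-negligible (~` range (iotaX A))] /\
  (* (e) *)
  ((forall i, fin_A1 A i ->
      [/\ continuous (fun z : Xhat A * Xhat A => dhatfin i z.1 z.2),
          (exists M : R, forall phi1 phi2, dhatfin i phi1 phi2 <= M),
          ext_semidistance (fun phi1 phi2 => (dhatfin i phi1 phi2)%:E) &
          forall x y, dhatfin i (iotaX A x) (iotaX A y) = dfin i x y]) /\
   [/\ (forall phi1 phi2, dhat A phi1 phi2 =
          ereal_sup [set (dhatfin i phi1 phi2)%:E | i in fin_A1 A]),
       ext_distance (dhat A) &
       forall x y, dhat A (iotaX A x) (iotaX A y) = d x y]) /\
  (* (f) *)
  [/\ emtm_space (dhat A) (mhat A m),
      compact [set: Xhat A],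
      compatible_algebra (dhat A) (Gamma A @` A) &
      measure_preserving_embedding d (dhat A) m (mhat A m)
        A (Gamma A @` A) (iotaX A)] /\
  (* (g) *)
  (forall (p : R) (p1 : (1 <= p%:E)%E),
     exists iota_star : {linear LspaceType m p1 -> LspaceType (mhat A m) p1},
       [/\ cancel (iota_pullback A m p1) iota_star,
           cancel iota_star (iota_pullback A m p1),
           (forall u, `|iota_star u| = `|u|),
           (forall f : alg A,
              iota_star (Lcb m p1 (alg_Cb f)) = Lcb (mhat A m) p1 (Gamma_Cb f)) &
           forall S : {linear LspaceType m p1 -> LspaceType (mhat A m) p1},
             (forall u, `|S u| = `|u|) ->
             (forall f : alg A,
                S (Lcb m p1 (alg_Cb f)) = Lcb (mhat A m) p1 (Gamma_Cb f)) ->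
             S =1 iota_star]).
Proof.
have [[hX dX _ _] rm] := HX.
split; first split.
- split.
  + exact: iota_continuous.
  + exact: injective_iota.
  + exact: dense_iota.
  + exact: compact_Xhat.
  + exact: hausdorff_Xhat.
- exact: metrizable_Xhat.
split.
  rewrite (homeo_onto_imageP (injective_iota dX)).
  by split=> [gA|[]//]; split=> //; exact: alg_compatible.
split.
  split.
  - move=> f Af; split; [exact: Gamma_uclosure_Cb|exact: Gamma_iota|].
    move=> g cg gf; apply: eq_on_iota => //; first by have [] := Gamma_uclosure_Cb Af.
    by rewrite gf Gamma_iota.
  - exact: Gamma_unital_subalgebra.
  - exact: Gamma_image_Cb.
  - by move=> f [cf _]; apply/closure_unifP; exact: Gamma_uniformly_dense.
  - exact: Gamma_iota_image.
split.
  split; [exact: radon_mhat|exact: completed_range_iota|exact: negligible_range_iota].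
split.
  split=> [i [fi _]|].
    split; [exact: dhatfin_continuous|exact: dhatfin_bounded|
      exact: ext_semidistance_dhatfin|exact: dhatfin_iota].
  by split; [exact: dhatE|exact: ext_distance_dhat|exact: dhat_iota].
split.
  split.
  - by split; [exact: emt_space_Xhat|exact: radon_mhat].
  - exact: compact_Xhat.
  - exact: compatible_Gamma.
  - split; first split; [exact: iota_continuous|exact: injective_iota|exact: dhat_iota|by []|].
    by move=> _ /GammaP[f ->]; exact: (alg_funP f).
by move=> p p1; exact: iota_star_ex.
Qed.
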